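(* Let $(Q,\mathfrak m_Q,\mathsf k)$ be a Gorenstein Artin local ring with $G=\mathrm{gr}(Q)$ and $\ell\ell(Q)=s$. Assume $G\simeq A\times_{\mathsf k}B$, where $A$ is a graded Gorenstein $\mathsf k$-algebra with $\ell\ell(A)=s$, and $B$ is a graded $\mathsf k$-algebra with $\ell\ell(B)=k\ge1$, where $s>k+1$. Let $J=\langle z_1,\ldots,z_n\rangle\subset(0:_Q\mathfrak m_Q^{k+1})$ be such that the images of $z_1,\ldots,z_n$ form a $\mathsf k$-basis of $((0:_Q\mathfrak m_Q^{k+1})+\mathfrak m_Q^2)/\mathfrak m_Q^2$, and let $I=\langle y_1,\ldots,y_m\rangle\subset Q$ be such that $\mathfrak m_A$ is minimally generated by $\{y_1^*,\ldots,y_m^*\}$. Then the following hold: (a) $\mathrm{edim}(B)=\mu(J)=n$, $J+\mathfrak m_Q^2=(0:_Q\mathfrak m_Q^{s-1})$, and if $k=1$, then $(0:_Q\mathfrak m_Q^{s-1})\subset J+(0:_QJ)$. (b) $\mathfrak m_B$ and $\mathfrak m_Q$ are minimally generated by $\{z_1^*,\ldots,z_n^*\}$ and $\{y_1,\ldots,y_m,z_1,\ldots,z_n\}$ respectively. In particular, $\mathfrak m_Q=I+J$. (c) $J\mathfrak m_Q^k=\mathrm{soc}(Q)$, and $J^k\ne0$. (d) $IJ\subset\mathfrak m_Q^3$, $I^kJ+J^{k+1}\subset\mathrm{soc}(Q)$, and $I^aJ^b=0$ for $a+b=k+1$ and $2\le b\le k$. (e) $\mathfrak m_Q^i=I^i$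 for $i\ge k+1$.
   Context: For an Artinian local ring $(T,\mathfrak m,\mathsf k)$: $\mu(M)$ is the minimal number of generators of a $T$-module $M$, $\mathrm{edim}(T)=\mu(\mathfrak m)$, $\mathrm{soc}(T)=\mathrm{ann}_T(\mathfrak m)$, and the Loewy length is $\ell\ell(T)=\max\{n:\mathfrak m^n\ne0\}$. $\mathrm{gr}(T)=\bigoplus_{i\ge0}\mathfrak m^i/\mathfrak m^{i+1}$ is the associated graded ring. For $0\ne x\in T$ with $x\in\mathfrak m^i\setminus\mathfrak m^{i+1}$, the initial form $x^*\in\mathrm{gr}(T)$ is the image of $x$ in $\mathfrak m^i/\mathfrak m^{i+1}$. The same notation is used for Artinian standard graded $\mathsf k$-algebras with their homogeneous maximal ideal. ''Graded Gorenstein'' means Artinian graded with one-dimensional socle. The fibre product over $\mathsf k$ is $A\times_{\mathsf k}B=\{(a,b)\in A\times B:\pi_A(a)=\pi_B(b)\}$, where $\pi_A,\pi_B$ are the natural projections onto $\mathsf k$. The isomorphism $G\simeq A\times_{\mathsf k}B$ is of graded rings, with $A_0=B_0=\mathsf k$ (so $A$, $B$ are standard graded). Via this isomorphism the homogeneous maximal ideal of $G$ is $\mathfrak m_A\times\mathfrak m_B$, and the homogeneous maximal ideals $\mathfrak m_A$ of $A$ and $\mathfrak m_B$ of $B$ are identified with the ideals $\mathfrak m_A\times0$ and $0\times\mathfrak m_B$ of $G$. *)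

(* Defs.v *)
From HB Require Import structures.
From mathcomp Require Import all_boot all_algebra.
From mathcomp Require Import boolp classical_sets.

Set Implicit Arguments.
Unset Strict Implicit.
Unset Printing Implicit Defensive.

Import GRing.Theory.
Local Open Scope classical_set_scope.
Local Open Scope ring_scope.

Section Ideals.
Variable R : comNzRingType.
Implicit Types I J M N S : set R.

Definition is_ideal I :=
  [/\ I 0, forall x y, I x -> I y -> I (x + y) & forall a x, I x -> I (a * x)].

Definition ideal_gen S : set R :=
  [set x | forall I, is_ideal I -> S `<=` I -> I x].

Definition idealD I J : set R := [set x + y | x in I & y in J].
Definition idealM I J : set R := ideal_gen [set x * y | x in I & y in J].

Fixpoint idealX I n : set R :=
  if n is n'.+1 then idealM I (idealX I n') else setT.

(* The annihilator (0 :_R I) *)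
Definition ann I : set R := [set x | forall y, I y -> x * y = 0].

Definition maximal_ideal M :=
  [/\ is_ideal M, M <> setT &
      forall I, is_ideal I -> M `<=` I -> I = M \/ I = setT].

Definition local_ring M := forall I, maximal_ideal I <-> I = M.

Definition artinian_ring :=
  forall I : nat -> set R, (forall n, is_ideal (I n)) ->
    (forall n, I n.+1 `<=` I n) -> exists n, forall p, (n <= p)%N -> I p = I n.

Definition minimally_generates (T : finType) (x : T -> R) I :=
  ideal_gen (range x) = I /\
  forall i, ideal_gen (x @` [set j | j != i]) <> I.

(* mu(I) = n *)
Definition min_num_gens I n :=
  (exists x : 'I_n -> R, ideal_gen (range x) = I) /\
  forall p (x : 'I_p -> R), ideal_gen (range x) = I -> (n <= p)%N.

(* Here M is the (homogeneous) maximal ideal of R. *)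
Definition embdim M n := min_num_gens M n.
Definition socle M := ann M.
Definition loewy_length M n :=
  idealX M n <> [set 0] /\ forall i, idealX M i <> [set 0] -> (i <= n)%N.

(* The images of the v i form an (R/M)-basis of I/N, where N `<=` I are ideals
   with M I `<=` N; scalars of R/M are represented by elements of R. *)
Definition quot_basis M I N n (v : 'I_n -> R) :=
  [/\ forall i, I (v i),
      forall x, I x -> exists c : 'I_n -> R, N (x - \sum_i c i * v i) &
      forall c : 'I_n -> R, N (\sum_i c i * v i) -> forall i, M (c i)].

(* Artinian, with one-dimensional socle over R/M *)
Definition gorenstein_artinian M :=
  artinian_ring /\
  exists w : R, quot_basis M (socle M) [set 0] (fun _ : 'I_1 => w).

Lemma is_ideal_gen S : is_ideal (ideal_gen S).
Proof.
split=> [I [] //|x y Sx Sy I II SI|a x Sx I II SI].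
  by case: (II) => _ + _; apply; [exact: Sx | exact: Sy].
by case: (II) => _ _; apply; exact: Sx.
Qed.

Lemma sub_ideal_gen S : S `<=` ideal_gen S.
Proof. by move=> x Sx I _; exact. Qed.

Lemma is_idealX I n : is_ideal (idealX I n).
Proof. by case: n => [|n]; [split | exact: is_ideal_gen]. Qed.

Lemma idealXSS I n : idealX I n.+1 `<=` idealX I n.
Proof.
move=> x; apply; first exact: is_idealX.
by move=> _ [a _ [b Xb <-]]; case: (is_idealX I n) => _ _; apply.
Qed.

Lemma idealXMM I i j x y :
  idealX I i x -> idealX I j y -> idealX I (i + j) (x * y).
Proof.
move=> + Xy; elim: i x => [x _|i IHi x].
  by case: (is_idealX I j) => _ _; apply.
have [X0 XD XM] := is_idealX I (i.+1 + j).
move=> /(_ [set x | idealX I (i.+1 + j) (x * y)]); apply.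
  split=> [|u v Xu Xv|a u Xu] /=; rewrite ?mul0r ?mulrDl -?mulrA;
  [exact: X0 | exact: XD | exact: XM].
move=> _ [a Ia [b Xb <-]]; apply: sub_ideal_gen.
by exists a => //; exists (b * y); [exact: IHi | rewrite mulrA].
Qed.

Lemma idealX_sum I n (T : Type) (r : seq T) (P : pred T) (F : T -> R) :
  (forall i, P i -> idealX I n (F i)) -> idealX I n (\sum_(i <- r | P i) F i).
Proof. by have [X0 XD _] := is_idealX I n; exact: big_ind. Qed.

End Ideals.

Coercion ideal_set (R : comNzRingType) (I : idealr R) : set R :=
  [set x | x \in I].

(* gr(R) = (+)_i m^i / m^(i+1) is built as the quotient of the Rees ring
   (+)_i m^i X^i, a subring of {poly R}, by its ideal (+)_i m^(i+1) X^i. *)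
Section AssociatedGraded.
Variables (R : comNzRingType) (m : idealr R).

Definition rees : {pred {poly R}} := fun p => `[< forall i, idealX m i p`_i >].

Lemma rees_subring_closed : subring_closed rees.
Proof.
split=> [|p q /asboolP Rp /asboolP Rq|p q /asboolP Rp /asboolP Rq];
  apply/asboolP => i.
- by rewrite coef1; case: i => //= i; case: (is_idealX m i.+1).
- have [_ XD XM] := is_idealX m i.
  by rewrite coefB -mulN1r; apply: XD => //; exact: XM.
- rewrite coefM; apply: idealX_sum => j _.
  by rewrite -[X in idealX _ X](subnKC (ltnSE (ltn_ord j))); exact: idealXMM.
Qed.

HB.instance Definition _ :=
  GRing.isSubringClosed.Build {poly R} rees rees_subring_closed.

Record rees_ring := Rees { rees_val : {poly R}; _ : rees_val \in rees }.

HB.instance Definition _ := [isSub for rees_val].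
HB.instance Definition _ := [Choice of rees_ring by <:].
HB.instance Definition _ := [SubChoice_isSubComNzRing of rees_ring by <:].

Definition rees_shift : {pred rees_ring} :=
  fun p => `[< forall i, idealX m i.+1 (val p)`_i >].

Lemma rees_shift_idealr_closed : idealr_closed rees_shift.
Proof.
split=> [||a p q /asboolP Ip /asboolP Iq].
- by apply/asboolP => i; rewrite coef0; case: (is_idealX m i.+1).
- apply/asboolP => /(_ 0); rewrite coef1 /= => X1.
  have m1 : (m : set R) 1.
    apply: X1; last by move=> _ [a ma [b _ <-]]; rewrite mulrC; exact: idealMr.
    by split=> [|x y|b x]; [exact: rpred0 | exact: rpredD | exact: idealMr].
  by move: m1; rewrite /ideal_set /= idealr1.
- apply/asboolP => i; have [_ XD _] := is_idealX m i.+1.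
  rewrite coefD; apply: XD => //; rewrite coefM; apply: idealX_sum => j _.
  have := @idealXMM _ m j (i - j).+1 (val a)`_j (val p)`_(i - j).
  rewrite addnS (subnKC (ltnSE (ltn_ord j))); apply=> //.
  by case: a => a /= /asboolP.
Qed.

HB.instance Definition _ :=
  isIdealr.Build rees_ring rees_shift rees_shift_idealr_closed.

Definition gr : comNzRingType := {ideal_quot rees_shift}.

(* The class in m^i / m^(i+1) of x in m^i; meaningless if x is not in m^i. *)
Definition gr_class (i : nat) (x : R) : gr :=
  (\pi_{ideal_quot rees_shift} (insubd (0 : rees_ring) (x *: 'X^i)))%qT.

Definition gr_comp (i : nat) : set gr := gr_class i @` idealX m i.

(* The i such that x is in m^i but not in m^(i+1). *)
Definition adic_order (x : R) : nat :=
  xget 0%N [set i | idealX m i x /\ ~ idealX m i.+1 x].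

(* x^*, with value 0 when x lies in every power of m *)
Definition initial_form (x : R) : gr := gr_class (adic_order x) x.

End AssociatedGraded.

Arguments gr_class {R} m i x.
Arguments gr_comp {R} m i.
Arguments initial_form {R} m x.

Section GradedAlgebras.
Variables (F : fieldType) (A : comAlgType F).
Implicit Types (gA : nat -> set A) (p : {rmorphism A -> F}).

(* A = (+)_i gA i is graded, with gA 0 = F. *)
Definition graded_algebra gA :=
  [/\ gA 0%N = range (fun c : F => c%:A),
      forall i, gA i 0 /\ forall (c : F) x y, gA i x -> gA i y -> gA i (c *: x + y),
      forall i j x y, gA i x -> gA j y -> gA (i + j)%N (x * y),
      forall x, exists n (f : nat -> A),
        (forall i, gA i (f i)) /\ x = \sum_(i < n) f i &
      forall n (f : nat -> A), (forall i, gA i (f i)) ->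
        \sum_(i < n) f i = 0 -> forall i, (i < n)%N -> f i = 0].

(* The homogeneous maximal ideal (+)_(i > 0) gA i *)
Definition hom_max gA : set A :=
  [set x | exists n (f : nat -> A),
    (forall i, gA i.+1 (f i)) /\ x = \sum_(i < n) f i].

(* p is the projection of A = F (+) hom_max gA onto F. *)
Definition natural_projection gA p :=
  (forall c : F, p c%:A = c) /\ (forall a, p a = 0 <-> hom_max gA a).

End GradedAlgebras.

Section FibreProduct.
Variables (F : fieldType) (A B : comAlgType F).
Variables (pA : {rmorphism A -> F}) (pB : {rmorphism B -> F}).

Definition fibre_pred : {pred A * B} := fun u => pA u.1 == pB u.2.

Lemma fibre_subring_closed : subring_closed fibre_pred.
Proof.
split=> [|u v /eqP uE /eqP vE|u v /eqP uE /eqP vE]; apply/eqP => /=.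
- by rewrite !rmorph1.
- by rewrite !rmorphB uE vE.
- by rewrite !rmorphM uE vE.
Qed.

HB.instance Definition _ :=
  GRing.isSubringClosed.Build (A * B)%type fibre_pred fibre_subring_closed.

Record fibre_prod := FibreProd {
  fibre_val : (A * B)%type; _ : fibre_val \in fibre_pred }.

HB.instance Definition _ := [isSub for fibre_val].
HB.instance Definition _ := [Choice of fibre_prod by <:].
HB.instance Definition _ := [SubChoice_isSubComNzRing of fibre_prod by <:].

Definition fibre_comp (gA : nat -> set A) (gB : nat -> set B) (i : nat) :
    set fibre_prod :=
  [set u | gA i (val u).1 /\ gB i (val u).2].

Definition left_ideal (mA : set A) : set fibre_prod :=
  [set u | mA (val u).1 /\ (val u).2 = 0].

Definition right_ideal (mB : set B) : set fibre_prod :=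
  [set u | (val u).1 = 0 /\ mB (val u).2].

End FibreProduct.

(* f is an isomorphism of graded rings. *)
Definition graded_iso (R S : comNzRingType) (gR : nat -> set R)
    (gS : nat -> set S) (f : {rmorphism R -> S}) :=
  bijective f /\ forall i x, gR i x <-> gS i (f x).

(* F, via p, is the residue field R/m. *)
Definition residue_field (R : comNzRingType) (m : set R) (F : fieldType)
    (p : {rmorphism R -> F}) :=
  (forall c, exists x, p x = c) /\ (forall x, p x = 0 <-> m x).

(* Main.v *)
(** In gr Q = A x_k B the homogeneous elements of degree i > k lie in A. If
    x in m has initial form in B, then x annihilates m^(s-1), and, going down
    from i + 1 to i > k, multiplication by x on m^i is a functional on A_i with
    values in soc Q = A_s; as A is Gorenstein it is also multiplication by some
    element of m^(s-i), which is contained in m^2. Hence x lies in (0 : m^(k+1)) + m^2, so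
    that the initial forms of the z_i are a basis of B_1. The rest is
    bookkeeping of initial forms and Nakayama's lemma: only J m^k <> 0 needs
    another look, and it holds because otherwise the elements of J^k of order k
    would lie in soc Q = m^s. *)

Require Import Defs.
From HB Require Import structures.
From mathcomp Require Import all_boot all_algebra ring.
From mathcomp Require Import boolp classical_sets.

Set Implicit Arguments.
Unset Strict Implicit.
Unset Printing Implicit Defensive.

Import GRing.Theory.
Local Open Scope classical_set_scope.
Local Open Scope ring_scope.

(** * Ideals *)

(** The duality step is carried out inside Q: on a finitely generated ideal, functionals with values
    in the simple socle are treated one generator at a time, so that no quotient m^i/m^(i+1) has to
    become a vector space. The finite list of generators that this needs comes from m^i = I^i for i
    > k, which is therefore proved first. The bound i > k serves a second purpose: there an element
    of m^i killed by m^(s-i) falls into m^(i+1), because B_i = 0 while A_i pairs perfectly with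
    A_(s-i). The inequality s > k + 1 also enters as 1 + (k + 1) <= s: the same pairing then forces
    elements killed by m^(k+1) to have no A-part in degree one. A further obstacle is that the y_i
    are known only through their initial forms, whose degrees are not prescribed; statements about
    them are extracted from degree-one coefficients in the Rees ring. *)

Section IdealCalculus.
Variable R : comNzRingType.
Implicit Types I J K M N S : set R.

Lemma is_ideal0 I : is_ideal I -> I 0.
Proof. by case. Qed.

Lemma is_idealD I x y : is_ideal I -> I x -> I y -> I (x + y).
Proof. by case=> _ + _; apply. Qed.

Lemma is_idealMl I a x : is_ideal I -> I x -> I (a * x).
Proof. by case=> _ _; apply. Qed.

Lemma is_idealMr I a x : is_ideal I -> I x -> I (x * a).
Proof. by move=> II Ix; rewrite mulrC; exact: is_idealMl. Qed.

Lemma is_idealN I x : is_ideal I -> I x -> I (- x).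
Proof. by move=> II Ix; rewrite -mulN1r; exact: is_idealMl. Qed.

Lemma is_idealB I x y : is_ideal I -> I x -> I y -> I (x - y).
Proof. by move=> II Ix Iy; apply: is_idealD => //; exact: is_idealN. Qed.

Lemma is_ideal_sum I (T : Type) (r : seq T) (P : pred T) (f : T -> R) :
  is_ideal I -> (forall i, P i -> I (f i)) -> I (\sum_(i <- r | P i) f i).
Proof. by move=> [I0 ID _]; exact: big_ind. Qed.

Lemma is_ideal_set0 : is_ideal [set 0 : R].
Proof.
split=> [//|x y -> ->|a x ->] /=; first by rewrite addr0.
by rewrite mulr0.
Qed.

Lemma is_ideal_ann I : is_ideal (ann I).
Proof.
split=> [y _|x y Ix Iy u Iu|a x Ix u Iu]; first by rewrite mul0r.
  by rewrite mulrDl Ix ?Iy ?addr0.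
by rewrite -mulrA Ix ?mulr0.
Qed.

Lemma is_ideal_idealr (m : idealr R) : is_ideal m.
Proof.
split=> [|x y|b x]; [exact: rpred0 | exact: rpredD | exact: idealMr].
Qed.

Lemma is_ideal_idealD I J : is_ideal I -> is_ideal J -> is_ideal (idealD I J).
Proof.
move=> II IJ; split.
- by exists 0; [exact: is_ideal0 | exists 0; [exact: is_ideal0 | rewrite addr0]].
- move=> _ _ [a Ia [b Jb <-]] [c Ic [d Jd <-]].
  exists (a + c); first exact: is_idealD.
  by exists (b + d); [exact: is_idealD | rewrite addrACA].
- move=> c _ [a Ia [b Jb <-]]; exists (c * a); first exact: is_idealMl.
  by exists (c * b); [exact: is_idealMl | rewrite mulrDr].
Qed.

Lemma idealD_le I J K :
  is_ideal K -> I `<=` K -> J `<=` K -> idealD I J `<=` K.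
Proof. by move=> IK IsK JsK _ [a /IsK Ka [b /JsK Kb <-]]; exact: is_idealD. Qed.

Lemma sub_idealDl I J : is_ideal J -> I `<=` idealD I J.
Proof. by move=> IJ x Ix; exists x => //; exists 0; rewrite ?addr0 //; exact: is_ideal0. Qed.

Lemma sub_idealDr I J : is_ideal I -> J `<=` idealD I J.
Proof. by move=> IJ x Ix; exists 0; [exact: is_ideal0 | exists x; rewrite ?add0r]. Qed.

Lemma ideal_gen_le S K : is_ideal K -> S `<=` K -> ideal_gen S `<=` K.
Proof. by move=> IK SK x; exact. Qed.

Lemma idealM_le I J K :
  is_ideal K -> (forall x y, I x -> J y -> K (x * y)) -> idealM I J `<=` K.
Proof.
by move=> IK IJK; apply: ideal_gen_le => // _ [x Ix [y Jy <-]]; exact: IJK.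
Qed.

Lemma idealM_mem I J x y : I x -> J y -> idealM I J (x * y).
Proof. by move=> Ix Jy; apply: sub_ideal_gen; exists x => //; exists y. Qed.

Lemma is_ideal_idealM I J : is_ideal (idealM I J).
Proof. exact: is_ideal_gen. Qed.

Lemma idealX_le I M n : I `<=` M -> idealX I n `<=` idealX M n.
Proof.
move=> IM; elim: n => [//|n IHn] /=.
apply: idealM_le => [|x y /IM Mx /IHn My]; first exact: is_ideal_idealM.
exact: idealM_mem.
Qed.

Lemma idealX1 I : is_ideal I -> idealX I 1 = I.
Proof.
move=> II; apply/seteqP; split=> [|x Ix].
  by apply: (@idealM_le I setT I) => // u v Iu _; exact: is_idealMr.
by rewrite -[x]mulr1; exact: idealM_mem.
Qed.

Lemma idealX_anti I i j : (i <= j)%N -> idealX I j `<=` idealX I i.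
Proof.
move=> /subnK <-; elim: (j - i)%N => [//|d IHd] x.
by rewrite addSn => /idealXSS; exact: IHd.
Qed.

Lemma idealX_prod I n x y : I x -> idealX I n y -> idealX I n.+1 (x * y).
Proof. exact: idealM_mem. Qed.

Lemma idealX_mul_le I i j n x y :
  (n <= i + j)%N -> idealX I i x -> idealX I j y -> idealX I n (x * y).
Proof. by move=> nij Ix Iy; apply: (idealX_anti nij); exact: idealXMM. Qed.

(** The predicate [P] lets one statement serve both a full family and, as in [minimally_generates],
    a family with one index removed. *)
Lemma ideal_gen_imageP (T : finType) (x : T -> R) (P : pred T) a :
  ideal_gen (x @` [set j | P j]) a <->
  exists c : T -> R, a = \sum_(j | P j) c j * x j.
Proof.
split=> [|[c ->]]; last first.
  apply: is_ideal_sum => [|j Pj]; first exact: is_ideal_gen.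
  by apply: is_idealMl (is_ideal_gen _) _; apply: sub_ideal_gen; exists j.
move=> /(_ [set a | exists c : T -> R, a = \sum_(j | P j) c j * x j]); apply.
  split=> [|u v [c ->] [d ->]|b u [c ->]].
  - by exists (fun=> 0); rewrite big1 // => j _; rewrite mul0r.
  - exists (fun j => c j + d j); rewrite -big_split; apply: eq_bigr => j _.
    by rewrite mulrDl.
  - exists (fun j => b * c j); rewrite mulr_sumr; apply: eq_bigr => j _.
    by rewrite mulrA.
move=> _ [j Pj <-]; exists (fun i => (i == j)%:R).
rewrite (bigD1 j) //= eqxx mul1r big1 ?addr0 // => i /andP[_ /negPf ->].
by rewrite mul0r.
Qed.

Lemma ideal_gen_rangeP (T : finType) (x : T -> R) a :
  ideal_gen (range x) a <-> exists c : T -> R, a = \sum_j c j * x j.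
Proof.
rewrite -(ideal_gen_imageP x predT); suff -> : setT = [set j : T | predT j] by [].
by apply/seteqP; split.
Qed.

Lemma ideal_gen_range_le (T : finType) (x : T -> R) K :
  is_ideal K -> (forall i, K (x i)) -> ideal_gen (range x) `<=` K.
Proof. by move=> IK Kx; apply: ideal_gen_le => // _ [i _ <-]. Qed.

Lemma mem_ideal_gen_range (T : Type) (x : T -> R) i : ideal_gen (range x) (x i).
Proof. by apply: sub_ideal_gen; exists i. Qed.

(** Generators are kept in a list so that the duality lemma can induct on them and so that products
    of ideals visibly stay finitely generated. *)
Definition seq_ideal (s : seq R) : set R := ideal_gen [set x | x \in s].

Lemma seq_ideal_cons v s u :
  seq_ideal (v :: s) u -> exists c, exists2 w, seq_ideal s w & u = c * v + w.
Proof.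
move=> /(_ [set u | exists c, exists2 w, seq_ideal s w & u = c * v + w]); apply.
  split=> [|u1 u2 [c1 [w1 sw1 ->]] [c2 [w2 sw2 ->]]|a u1 [c1 [w1 sw1 ->]]].
  - exists 0; exists 0; last by rewrite mul0r addr0.
    by apply: is_ideal0; exact: is_ideal_gen.
  - exists (c1 + c2); exists (w1 + w2); last by rewrite mulrDl addrACA.
    exact: is_idealD (is_ideal_gen _) _ _.
  - exists (a * c1); exists (a * w1); last by rewrite mulrDr mulrA.
    exact: is_idealMl (is_ideal_gen _) _.
move=> x /=; rewrite inE => /orP[/eqP->|sx].
  exists 1; exists 0; last by rewrite mul1r addr0.
  by apply: is_ideal0; exact: is_ideal_gen.
by exists 0; exists x; [exact: sub_ideal_gen | rewrite mul0r add0r].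
Qed.

Lemma seq_ideal_range (T : finType) (x : T -> R) :
  ideal_gen (range x) = seq_ideal (codom x).
Proof.
congr ideal_gen; apply/seteqP; split=> [_ [i _ <-]|_ /codomP[i ->]] /=.
  exact: codom_f.
by exists i.
Qed.

Lemma idealM_seq_ideal s t :
  idealM (seq_ideal s) (seq_ideal t) = seq_ideal [seq a * b | a <- s, b <- t].
Proof.
set st := [seq _ | a <- s, b <- t]; have Ist := is_ideal_gen [set x | x \in st].
apply/seteqP; split.
  apply: idealM_le => // x y sx ty.
  (* With one factor fixed, the admissible other factors form an ideal, so testing generators
     suffices; this is done for each factor in turn. *)
  move: sx => /(_ [set x | seq_ideal st (x * y)]); apply.
    split=> [|u v su sv|a u su] /=; rewrite ?mul0r ?mulrDl -?mulrA.
    - exact: is_ideal0 Ist.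
    - exact: is_idealD Ist _ _.
    - exact: is_idealMl Ist _.
  move=> {}x /= sx; move: ty => /(_ [set y | seq_ideal st (x * y)]); apply.
    split=> [|u v su sv|a u su] /=; rewrite ?mulr0 ?mulrDr ?(mulrCA x).
    - exact: is_ideal0 Ist.
    - exact: is_idealD Ist _ _.
    - exact: is_idealMl Ist _.
  by move=> {}y /= ty; apply: sub_ideal_gen; exact: allpairs_f.
apply: ideal_gen_le; first exact: is_ideal_idealM.
by move=> _ /= /allpairsP[[a b] [/= sa tb ->]]; apply: idealM_mem; exact: sub_ideal_gen.
Qed.

Lemma idealX_seq_ideal s n : exists t, idealX (seq_ideal s) n = seq_ideal t.
Proof.
elim: n => [|n [t tE]]; last by rewrite /= tE idealM_seq_ideal; eexists.
exists [:: 1]; apply/seteqP; split=> // x _; rewrite -[x]mulr1.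
by apply: is_idealMl (is_ideal_gen _) _; apply: sub_ideal_gen; rewrite /= inE.
Qed.

(** Substituting the inclusion into itself gives M contained in N + M^i for every i; nilpotency of M
    stands in for the finite generation of the usual Nakayama lemma. *)
Lemma nilpotent_nakayama M N e : is_ideal M -> is_ideal N ->
  idealX M e.+1 = [set 0] -> M `<=` idealD N (idealX M 2) -> M `<=` N.
Proof.
move=> IM IN Me MN.
have IX i : is_ideal (idealD N (idealX M i)).
  by apply: is_ideal_idealD => //; exact: is_idealX.
have MS i : idealX M i.+1 `<=` idealD N (idealX M i.+2).
  apply: idealM_le => // _ b /MN[n Nn [t Mt <-]] Mb; rewrite mulrDl.
  apply: is_idealD => //.
    apply: sub_idealDl; first exact: is_idealX.
    exact: is_idealMr.
  by apply: sub_idealDr => //; rewrite -[i.+2]add2n; exact: idealXMM.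
have ME i : M `<=` idealD N (idealX M i.+1).
  elim: i => [|i IHi] x Mx.
    by apply: sub_idealDr => //; rewrite idealX1.
  have [n Nn [t /MS + <-]] := IHi x Mx.
  by apply: is_idealD => //; apply: sub_idealDl => //; exact: is_idealX.
by move=> x /(ME e)[n Nn]; rewrite Me => -[t -> <-]; rewrite addr0.
Qed.

(** * Independence of generators over a residue field *)

Section Independence.
Variables (F : fieldType) (p : {rmorphism R -> F}).

(** For generators of an ideal K this amounts to independence of their images in K/(ker p)K.
    Speaking of relations only, it applies alike to Q, to B and to [gr]. *)
Definition indep_mod_ker (T : finType) (x : T -> R) :=
  forall e : T -> R, \sum_i e i * x i = 0 -> forall i, p (e i) = 0.

(** Each family is expressed through the other. By independence the product of the two transition
    matrices becomes the identity over [F], and an identity of size [n] factors through size [q]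
    only if [n <= q]. *)
Lemma indep_leq_gens n (x : 'I_n -> R) q (w : 'I_q -> R) :
  indep_mod_ker x -> ideal_gen (range w) = ideal_gen (range x) -> (n <= q)%N.
Proof.
move=> xI wx.
have /choice[c cE] : forall i, exists c : 'I_q -> R, x i = \sum_j c j * w j.
  by move=> i; apply/ideal_gen_rangeP; rewrite wx; exact: mem_ideal_gen_range.
have /choice[d dE] : forall j, exists d : 'I_n -> R, w j = \sum_i d i * x i.
  by move=> j; apply/ideal_gen_rangeP; rewrite -wx; exact: mem_ideal_gen_range.
apply: (@mulmx1_min F n q (\matrix_(i, j) p (c i j)) (\matrix_(j, i) p (d j i))).
apply/matrixP => i l; rewrite !mxE.
have := xI (fun l => \sum_j c i j * d j l - (i == l)%:R).
move=> /(_ _ l)/=; rewrite rmorphB rmorph_nat => xI'.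
apply/eqP; rewrite -subr_eq0; apply/eqP; apply: etrans (xI' _).
  by rewrite rmorph_sum; congr (_ - _); apply: eq_bigr => j _; rewrite !mxE rmorphM.
transitivity (\sum_j c i j * w j - x i); last by rewrite cE subrr.
under eq_bigr do rewrite mulrBl.
rewrite big_split /= sumrN; congr (_ - _).
  under eq_bigr do rewrite mulr_suml.
  rewrite exchange_big; apply: eq_bigr => j _; rewrite [in RHS]dE mulr_sumr.
  by apply: eq_bigr => t _; rewrite mulrA.
rewrite (bigD1 i) //= eqxx mul1r big1 ?addr0 // => t.
by rewrite eq_sym => /negPf ->; rewrite mul0r.
Qed.

(** A redundant generator would give a relation with coefficient -1, which [p] does not kill. *)
Lemma indep_minimally_generates (T : finType) (x : T -> R) K :
  indep_mod_ker x -> ideal_gen (range x) = K -> minimally_generates x K.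
Proof.
move=> xI xK; split=> // i iK.
have : K (x i) by rewrite -xK; exact: mem_ideal_gen_range.
rewrite -iK => /(ideal_gen_imageP x (fun j => j != i))[c cE].
have := xI (fun j => if j == i then - 1 else c j).
move=> /(_ _ i); rewrite eqxx rmorphN rmorph1 => h.
have : (- 1 : F) = 0.
  apply: h; rewrite (bigD1 i) //= eqxx mulN1r [X in - X]cE addrC.
  apply/eqP; rewrite subr_eq0; apply/eqP.  by apply: eq_bigr => j /negPf ->.
by move/eqP; rewrite oppr_eq0 oner_eq0.
Qed.

End Independence.

End IdealCalculus.

(** * The associated graded ring *)

Section AssociatedGradedTheory.
Variables (R : comNzRingType) (m : idealr R).
Implicit Types (P S : {poly R}) (x y : R).

(** [gr_class m i x] is the value at the monomial [x *: 'X^i]. Polynomial representatives give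
    access to coefficients without choosing homogeneous components in [gr]; [insubd] makes the map
    total, hence the membership conditions below. *)
Definition rees_class P : gr m :=
  (\pi_{ideal_quot (@rees_shift R m)} (insubd (0 : rees_ring m) P))%qT.

Lemma reesP P : reflect (forall i, idealX m i P`_i) (P \in rees m).
Proof. exact: asboolP. Qed.

Lemma rees_classB P S : P \in rees m -> S \in rees m ->
  rees_class (P - S) = rees_class P - rees_class S.
Proof.
move=> RP RS; rewrite /rees_class -rmorphB; congr (\pi_ _ _)%qT.
apply: val_inj; rewrite rmorphB /= !insubdK //; exact: rpredB.
Qed.

Lemma rees_classM P S : P \in rees m -> S \in rees m ->
  rees_class (P * S) = rees_class P * rees_class S.
Proof.
move=> RP RS; rewrite /rees_class -rmorphM; congr (\pi_ _ _)%qT.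
apply: val_inj; rewrite rmorphM /= !insubdK //; exact: rpredM.
Qed.

Lemma rees_class0 : rees_class 0 = 0.
Proof. by rewrite -[0 in LHS](subrr 0) rees_classB ?rpred0 // subrr. Qed.

Lemma rees_class1 : rees_class 1 = 1.
Proof.
rewrite /rees_class -(rmorph1 (\pi_{ideal_quot (@rees_shift R m)}%qT)).
congr (\pi_ _ _)%qT; apply: val_inj; rewrite rmorph1 /= insubdK //; exact: rpred1.
Qed.

Lemma rees_classD P S : P \in rees m -> S \in rees m ->
  rees_class (P + S) = rees_class P + rees_class S.
Proof.
move=> RP RS; rewrite -[S]opprK rees_classB ?rpredN //.
by rewrite -[X in rees_class P - rees_class X]sub0r rees_classB ?rpred0 // rees_class0
  sub0r !opprK.
Qed.

Lemma rees_class_sum (T : Type) (r : seq T) (p : pred T) (f : T -> {poly R}) :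
  (forall i, p i -> f i \in rees m) ->
  rees_class (\sum_(i <- r | p i) f i) = \sum_(i <- r | p i) rees_class (f i).
Proof.
move=> Rf; suff [] : rees_class (\sum_(i <- r | p i) f i) =
    \sum_(i <- r | p i) rees_class (f i) /\ \sum_(i <- r | p i) f i \in rees m by [].
elim/big_rec2: _ => [|i g G /Rf Rfi [<- RG]]; first by rewrite rees_class0 rpred0.
by rewrite rees_classD // rpredD.
Qed.

Lemma rees_class_eq0 P : P \in rees m ->
  rees_class P = 0 <-> forall i, idealX m i.+1 P`_i.
Proof.
move=> RP; apply: (@iff_trans _ (insubd (0 : rees_ring m) P \in @rees_shift R m)).
  rewrite -[X in X \in _]subr0 Quotient.idealrBE.
  rewrite /rees_class -(rmorph0 (\pi_{ideal_quot (@rees_shift R m)}%qT)).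
  by split=> /eqP.
split=> [/asboolP h i|h]; first by have := h i; rewrite /= insubdK.
by apply/asboolP => i; rewrite /= insubdK //; exact: h.
Qed.

Lemma rees_class_surj (g : gr m) : exists2 P, P \in rees m & g = rees_class P.
Proof.
have [P ->] : exists P : rees_ring m, g = (\pi_{ideal_quot (@rees_shift R m)} P)%qT.
  by exists (repr (g : {ideal_quot (@rees_shift R m)})); rewrite reprK.
by exists (val P); [exact: valP | rewrite /rees_class valKd].
Qed.

Lemma rees_monomial i x : idealX m i x -> x *: 'X^i \in rees m.
Proof.
move=> mx; apply/reesP => j; rewrite coefZ coefXn.
case: eqP => [->|_]; first by rewrite mulr1.
by rewrite mulr0; exact: is_ideal0 (is_idealX _ _).
Qed.

Lemma gr_classD i x y : idealX m i x -> idealX m i y ->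
  gr_class m i (x + y) = gr_class m i x + gr_class m i y.
Proof.
move=> mx my; rewrite [LHS]/gr_class scalerDl; apply: rees_classD; exact: rees_monomial.
Qed.

Lemma gr_classB i x y : idealX m i x -> idealX m i y ->
  gr_class m i (x - y) = gr_class m i x - gr_class m i y.
Proof.
move=> mx my; rewrite [LHS]/gr_class scalerBl; apply: rees_classB; exact: rees_monomial.
Qed.

Lemma gr_classM i j x y : idealX m i x -> idealX m j y ->
  gr_class m (i + j) (x * y) = gr_class m i x * gr_class m j y.
Proof.
move=> mx my; rewrite -[RHS]rees_classM; try exact: rees_monomial.
by rewrite -scalerAl -scalerAr -exprD scalerA.
Qed.

Lemma gr_class0 i : gr_class m i 0 = 0.
Proof. by rewrite /gr_class scale0r; exact: rees_class0. Qed.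

Lemma gr_class01 : gr_class m 0 1 = 1.
Proof. by rewrite /gr_class scale1r; exact: rees_class1. Qed.

Lemma gr_class_sum i (T : Type) (r : seq T) (p : pred T) (f : T -> R) :
  (forall j, p j -> idealX m i (f j)) ->
  gr_class m i (\sum_(j <- r | p j) f j) = \sum_(j <- r | p j) gr_class m i (f j).
Proof.
move=> mf; rewrite /gr_class scaler_suml; apply: rees_class_sum => j /mf.
exact: rees_monomial.
Qed.

Lemma gr_class_eq0 i x : idealX m i x ->
  gr_class m i x = 0 <-> idealX m i.+1 x.
Proof.
move=> mx; rewrite /gr_class -/(rees_class _) rees_class_eq0; last exact: rees_monomial.
split=> [/(_ i)|mx' j]; rewrite coefZ coefXn ?eqxx ?mulr1 //.
by case: eqP => [->|_]; rewrite ?mulr1 // mulr0; exact: is_ideal0 (is_idealX _ _).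
Qed.

Lemma rees_class_coef P : P \in rees m ->
  rees_class P = \sum_(i < size P) gr_class m i P`_i.
Proof.
move=> /reesP RP; rewrite -[P in LHS]coefK poly_def rees_class_sum // => i _.
by apply: rees_monomial.
Qed.

(** Comparing coefficients of ['X] turns a relation in [gr] into one in [R] modulo m^2. A generator
    placed in degree above one contributes no such coefficient and drops out. Arbitrary degrees
    [d j] are allowed because initial forms of generators are not known in advance to have degree
    one. *)
Lemma gr_class1_combination (T : finType) (P : T -> {poly R}) (d : T -> nat)
    (y : T -> R) x :
  (forall j, P j \in rees m) -> (forall j, idealX m (d j) (y j)) -> idealX m 1 x ->
  \sum_j rees_class (P j) * gr_class m (d j) (y j) = gr_class m 1 x ->
  idealX m 2 (\sum_(j | (d j <= 1)%N) (P j)`_(1 - d j) * y j - x).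
Proof.
move=> RP my mx.
have RM j : P j * (y j *: 'X^(d j)) \in rees m by rewrite rpredM ?rees_monomial.
under eq_bigr do rewrite -rees_classM ?rees_monomial //.
rewrite -rees_class_sum // => /eqP; rewrite -subr_eq0 -rees_classB ?rees_monomial ?rpred_sum //.
move/eqP/rees_class_eq0; rewrite rpredB ?rees_monomial ?rpred_sum // => /(_ isT 1%N).
rewrite coefB coef_sum coefZ coefX mulr1; congr (idealX _ _ (_ - _)).
rewrite [RHS]big_mkcond; apply: eq_bigr => j _.
by rewrite -scalerAr coefZ coefMXn ltnNge; case: leqP; rewrite ?mulr0 // mulrC.
Qed.

End AssociatedGradedTheory.

(** * Graded algebras *)

Section GradedAlgebraTheory.
Variables (F : fieldType) (A : comAlgType F) (gA : nat -> set A).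
Variable p : {rmorphism A -> F}.
Hypotheses (Agr : graded_algebra gA) (Aproj : natural_projection gA p).

Lemma graded0 i : gA i 0.
Proof. by case: Agr => _ /(_ i)[]. Qed.

Lemma gradedD i x y : gA i x -> gA i y -> gA i (x + y).
Proof.
case: Agr => _ /(_ i)[_ gAZD] _ _ _ gx gy; rewrite -[x]scale1r.
exact: gAZD.
Qed.

Lemma gradedZ i c x : gA i x -> gA i (c *: x).
Proof.
case: Agr => _ /(_ i)[gA0 gAZD] _ _ _ gx; rewrite -[c *: x]addr0.
exact: gAZD.
Qed.

Lemma gradedM i j x y : gA i x -> gA j y -> gA (i + j) (x * y).
Proof. by case: Agr => _ _ gM _ _; exact: gM. Qed.

Lemma graded_scalar c : gA 0 c%:A.
Proof. by case: Agr => -> _ _ _ _; exists c. Qed.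

Lemma graded_disjoint i j x : gA i x -> gA j x -> i != j -> x = 0.
Proof.
move=> gi gj ij; case: Agr => _ _ _ _ gfree.
(* The family with [x] in position [i] and [- x] in position [j] sums to zero. *)
have := gfree (i + j).+1 (fun l => (l == i)%:R * x - (l == j)%:R * x).
move=> /(_ _ _ i); rewrite eqxx (negPf ij) mul1r mul0r subr0; apply.
- move=> l; case: eqP => [->|_]; first by rewrite (negPf ij) mul1r mul0r subr0.
  rewrite mul0r sub0r; case: eqP => [->|_]; last by rewrite mul0r oppr0; exact: graded0.
  by rewrite mul1r -scaleN1r; exact: gradedZ.
- have s1 (t : nat) : (t <= i + j)%N -> \sum_(l < (i + j).+1) (l == t :> nat)%:R * x = x.
    rewrite -ltnS => ltt; rewrite (bigD1 (Ordinal ltt)) //= eqxx mul1r big1 ?addr0 // => l.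
    by rewrite -val_eqE /= => /negPf ->; rewrite mul0r.
  by rewrite sumrB !s1 ?leq_addr ?leq_addl // subrr.
- by rewrite ltnS leq_addr.
Qed.

(** For [n = 1] this is [hom_max gA] by conversion; in general it bounds the [n]-th power of that
    ideal from above. *)
Definition graded_tail n : set A := [set x | exists N (f : nat -> A),
  (forall i, gA (n + i) (f i)) /\ x = \sum_(i < N) f i].

Lemma graded_tail_mem n i x : (n <= i)%N -> gA i x -> graded_tail n x.
Proof.
move=> ni gx; exists (i - n).+1, (fun j => if j == (i - n)%N then x else 0); split.
  by move=> j; case: eqP => [->|_]; [rewrite subnKC | exact: graded0].
rewrite big_ord_recr /= eqxx big1 ?add0r // => j _.
by rewrite (ltn_eqF (ltn_ord j)).
Qed.

Lemma graded_tailD n x y : graded_tail n x -> graded_tail n y -> graded_tail n (x + y).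
Proof.
move=> [N [f [gf ->]]] [M [g [gg ->]]].
pose trunc K (h : nat -> A) i := if (i < K)%N then h i else 0.
have truncE K (h : nat -> A) : (K <= N + M)%N -> \sum_(i < K) h i = \sum_(i < N + M) trunc K h i.
  by move=> KNM; rewrite (big_ord_widen _ _ KNM) big_mkcond.
exists (N + M)%N, (fun i => trunc N f i + trunc M g i); split.
  by move=> i; apply: gradedD; rewrite /trunc; case: ifP => // _; exact: graded0.
by rewrite big_split /= -!truncE ?leq_addr ?leq_addl.
Qed.

Lemma graded_tail_sum n (T : Type) (r : seq T) (P : pred T) (f : T -> A) :
  (forall j, P j -> graded_tail n (f j)) -> graded_tail n (\sum_(j <- r | P j) f j).
Proof.
move=> gf; apply: big_ind => //; last exact: graded_tailD.
exact: graded_tail_mem (leqnn n) (graded0 n).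
Qed.

Lemma graded_tailM i j x y :
  graded_tail i x -> graded_tail j y -> graded_tail (i + j) (x * y).
Proof.
move=> [N [f [gf ->]]] [M [g [gg ->]]]; rewrite mulr_suml.
apply: graded_tail_sum => a _; rewrite mulr_sumr; apply: graded_tail_sum => b _.
by apply: graded_tail_mem (gradedM (gf a) (gg b)); rewrite addnACA leq_addr.
Qed.

Lemma graded_tail0 x : graded_tail 0 x.
Proof. by case: Agr => _ _ _ /(_ x)[N [f [gf xE]]] _; exists N, f. Qed.

Lemma is_ideal_graded_tail n : is_ideal (graded_tail n).
Proof.
split=> [||a x nx]; last exact: (graded_tailM (graded_tail0 a) nx).
  exact: graded_tail_mem (leqnn n) (graded0 n).
exact: graded_tailD.
Qed.

Lemma is_ideal_hom_max : is_ideal (hom_max gA).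
Proof. exact: (is_ideal_graded_tail 1). Qed.

Lemma hom_max_graded i x : gA i.+1 x -> hom_max gA x.
Proof. exact: (@graded_tail_mem 1 i.+1). Qed.

Lemma proj_graded i x : gA i.+1 x -> p x = 0.
Proof. by move=> /hom_max_graded; case: Aproj => _ /(_ x)[]. Qed.

Lemma hom_maxX_tail n : idealX (hom_max gA) n `<=` graded_tail n.
Proof.
elim: n => [x _|n IHn]; first exact: graded_tail0.
apply: idealM_le => [|x y hx /IHn ty]; first exact: is_ideal_graded_tail.
exact: (@graded_tailM 1 n).
Qed.

(** This extracts a nonzero homogeneous element from a Loewy length. Its degree is only bounded
    below here; vanishing in higher degrees pins it down later. *)
Lemma hom_maxX_neq0 n : idealX (hom_max gA) n <> [set 0] ->
  exists2 i, (n <= i)%N & exists2 a, gA i a & a <> 0.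
Proof.
move=> nz; apply: contrapT => h; apply: nz; apply/seteqP; split=> x.
  move=> /hom_maxX_tail[N [f [gf ->]]] /=; apply: big1 => i _.
  apply: contrapT => fi; apply: h; exists (n + i)%N; first exact: leq_addr.
  by exists (f i).
by move=> ->; exact: is_ideal0 (is_idealX _ _).
Qed.

Lemma hom_max_sub_proj c : hom_max gA (c - (p c)%:A).
Proof.
case: Aproj => pA /(_ (c - (p c)%:A))[]; rewrite rmorphB pA subrr.
by move=> /(_ erefl).
Qed.

(** The top-degree element [t] is killed by all positive degrees, so it is a nonzero scalar multiple
    of the socle generator, and the socle is the line through [t]. *)
Lemma gorenstein_graded_socle (w t : A) d :
  quot_basis (hom_max gA) (socle (hom_max gA)) [set 0] (fun _ : 'I_1 => w) ->
  gA d t -> t <> 0 -> (forall i a, (d < i)%N -> gA i a -> a = 0) ->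
  forall a, socle (hom_max gA) a -> gA d a.
Proof.
move=> [wS wgen _] gt t0 gbig.
have scalar_w a : socle (hom_max gA) a -> exists c, a = c *: w.
  move=> /wgen[c]; rewrite big_ord1 => /eqP; rewrite subr_eq0 => /eqP ->.
  (* A coefficient differs from its residue by an element of the maximal ideal, which kills [w]; so
     scalars from [F] suffice. *)
  exists (p (c ord0)); have /(wS ord0) := hom_max_sub_proj (c ord0).
  rewrite mulrC mulrBl => /eqP; rewrite subr_eq0 => /eqP ->.
  by rewrite -scalerAl mul1r.
have [l tE] : exists l, t = l *: w.
  apply: scalar_w => _ [N [f [gf ->]]]; rewrite mulr_sumr big1 // => i _.
  by apply: gbig (gradedM gt (gf i)); rewrite addnS ltnS leq_addr.
have l0 : l != 0 by apply/eqP => l0; apply: t0; rewrite tE l0 scale0r.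
move=> a /scalar_w[c ->]; have -> : c *: w = (c / l) *: t.
  by rewrite tE scalerA mulfVK.
exact: gradedZ.
Qed.

(** Below degree [d] a nonzero homogeneous element is not in the socle, so some homogeneous element
    of positive degree multiplies it to something nonzero; repeating this ends in degree [d]. *)
Lemma gorenstein_graded_pairing d t :
  gorenstein_artinian (hom_max gA) -> gA d t -> t <> 0 ->
  (forall i a, (d < i)%N -> gA i a -> a = 0) ->
  forall i a, (i <= d)%N -> gA i a -> a <> 0 -> exists2 b, gA (d - i) b & a * b <> 0.
Proof.
move=> [_ [w wB]] gt t0 gbig i a; have socd := gorenstein_graded_socle wB gt t0 gbig.
have [e] := ubnP (d - i)%N; elim: e i a => // e IHe i a lt_e le_id ga a0.
have [->|ne_id] := eqVneq i d.
  by exists 1%:A; rewrite ?subnn; [exact: graded_scalar | rewrite scale1r mulr1].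
have nsoc : ~ socle (hom_max gA) a.
  by move=> /socd gda; apply: a0; exact: graded_disjoint ga gda ne_id.
have [h hm ah0] : exists2 h, hom_max gA h & a * h <> 0.
  apply: contrapT => nh; apply: nsoc => h hm; apply: contrapT => ah0.
  by apply: nh; exists h.
have [j [x gx ax0]] : exists j, exists2 x, gA j.+1 x & a * x <> 0.
  case: hm ah0 => N [f [gf ->]]; rewrite mulr_sumr => s0.
  apply: contrapT => nj; apply: s0; apply: big1 => j _; apply: contrapT => ax0.
  by apply: nj; exists j, (f j).
have gax := gradedM ga gx.
have le_d : (i + j.+1 <= d)%N.
  by rewrite leqNgt; apply/negP => /gbig /(_ gax).
have [|b gb axb0] := IHe _ _ _ le_d gax ax0.
  rewrite subnDA; apply: leq_trans (ltnSE lt_e).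
  by rewrite ltn_subrL /= subn_gt0 ltn_neqAle ne_id.
exists (x * b); last by rewrite mulrA.
have -> : (d - i = j.+1 + (d - (i + j.+1)))%N by rewrite subnDA subnKC // leq_subRL // addnC.
exact: gradedM.
Qed.

End GradedAlgebraTheory.

(** * Graded factors of the associated graded ring *)

Section FactorOfGr.
Variables (R : comNzRingType) (m : idealr R) (F : fieldType) (A B : comAlgType F).
Variables (gA : nat -> set A).
Variables (u : {rmorphism gr m -> A}) (v : {rmorphism gr m -> B}).
Local Notation cl := (gr_class m).
Local Notation mX := (idealX m).

Hypothesis Agr : graded_algebra gA.
Hypothesis uv_inj : forall g, u g = 0 -> v g = 0 -> g = 0.
Hypothesis u_graded : forall i x, mX i x -> gA i (u (cl i x)).
Hypothesis u_lift : forall i a, gA i.+1 a ->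
  exists x, [/\ mX i.+1 x, u (cl i.+1 x) = a & v (cl i.+1 x) = 0].

Lemma mX1 x : mX 1 x <-> (m : set R) x.
Proof. by rewrite idealX1 //; exact: is_ideal_idealr. Qed.

(** In positive degrees a fibre product is a direct product, so the other component can be removed;
    in degree zero the two are tied together by the residue field. *)
Lemma split_left i x : mX i.+1 x ->
  exists x', [/\ mX i.+1 x', u (cl i.+1 x') = u (cl i.+1 x) & v (cl i.+1 x') = 0].
Proof. by move=> /u_graded /u_lift. Qed.

Lemma gr_class_eq i x y : mX i x -> mX i y ->
  u (cl i x) = u (cl i y) -> v (cl i x) = v (cl i y) -> mX i.+1 (x - y).
Proof.
move=> mx my uxy vxy; apply/gr_class_eq0.
  by apply: is_idealB => //; exact: is_idealX.
by apply: uv_inj; rewrite gr_classB // rmorphB ?uxy ?vxy subrr.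
Qed.

(** Degree-one classes without [v]-part lift to [N], and products of such lifts represent products.
    In degree zero the [v]-part cannot be removed, whence the guard [0 < i]. The lemma is applied to
    both factors, with [u] and [v] exchanged for the second. *)
Lemma power_lift (N : set R) : is_ideal N -> N `<=` m ->
  (forall x, mX 1 x -> v (cl 1 x) = 0 -> idealD N (mX 2) x) ->
  forall i x, mX i x -> exists x',
    [/\ idealX N i x', u (cl i x') = u (cl i x) & (0 < i)%N -> v (cl i x') = 0].
Proof.
move=> IN Nm Nv; have NXm i x : idealX N i x -> mX i x by apply: idealX_le.
elim=> [x mx|i IHi]; first by exists x.
(* Membership in m^(i+1) is carried along because [gr_class] is additive only there. *)
suff : mX i.+1 `<=` [set x | mX i.+1 x /\ exists x',
    [/\ idealX N i.+1 x', u (cl i.+1 x') = u (cl i.+1 x) & v (cl i.+1 x') = 0]].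
  by move=> h x /h[_ [x' [Nx' ux' vx']]]; exists x'; split.
have IX := is_idealX m i.+1; have INX := is_idealX N i.+1.
apply: idealM_le.
  split=> [|x y [mx [x' [Nx' ux' vx']]] [my [y' [Ny' uy' vy']]]|a x [mx [x' [Nx' ux' vx']]]].
  - split; first exact: is_ideal0 IX.
    by exists 0; rewrite gr_class0 !rmorph0; split => //; exact: is_ideal0 INX.
  - split; first exact: is_idealD IX _ _.
    have [Mx' My'] := (NXm _ _ Nx', NXm _ _ Ny').
    exists (x' + y'); split; first exact: is_idealD INX _ _.
      by rewrite !gr_classD // !rmorphD ux' uy'.
    by rewrite gr_classD // rmorphD vx' vy' addr0.
  - split; first exact: is_idealMl IX _.
    have Mx' := NXm _ _ Nx'.
    have m0 b : mX 0 b by [].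
    exists (a * x'); split; first exact: is_idealMl INX _.
      by rewrite -[i.+1]add0n !gr_classM // !rmorphM ux'.
    by rewrite -[i.+1]add0n !gr_classM // !rmorphM vx' mulr0.
move=> x y /mX1 mx my.
have [x' [mx' ux' vx']] := split_left mx.
have [a Na [t mt atx]] := Nv _ mx' vx'.
have [y' [Ny' uy' _]] := IHi _ my.
have ma : mX 1 a by apply/mX1; exact: Nm.
have clax : cl 1 a = cl 1 x'.
  rewrite -atx gr_classD //; last exact: idealXSS.
  by rewrite ((gr_class_eq0 (idealXSS mt)).2 mt) addr0.
have My' := NXm _ _ Ny'.
split; first by rewrite -[i.+1]add1n; exact: idealXMM.
exists (a * y'); split; first exact: idealX_prod.
  by rewrite -[i.+1]add1n !gr_classM // !rmorphM clax ux' uy'.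
by rewrite -[i.+1]add1n !gr_classM // !rmorphM clax vx' mul0r.
Qed.

Lemma is_ideal_graded_le (K : set A) i :
  is_ideal K -> is_ideal [set x | mX i x /\ K (u (cl i x))].
Proof.
move=> IK; have IX := is_idealX m i; split.
- by split; [exact: is_ideal0 IX | rewrite gr_class0 rmorph0; exact: is_ideal0 IK].
- move=> x y [mx Kx] [my Ky]; split; first exact: is_idealD IX _ _.
  by rewrite gr_classD // rmorphD; exact: is_idealD IK _ _.
- move=> a x [mx Kx]; split; first exact: is_idealMl IX _.
  have m0 : mX 0 a by [].
  by rewrite -[i]add0n gr_classM // rmorphM; exact: is_idealMl IK _.
Qed.

Lemma graded_hom_maxX i x : mX i x -> idealX (hom_max gA) i (u (cl i x)).
Proof.
elim: i x => [//|i IHi] x mx.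
suff /(_ _ mx)[] : mX i.+1 `<=`
  [set x | mX i.+1 x /\ idealX (hom_max gA) i.+1 (u (cl i.+1 x))] by [].
apply: idealM_le; first by apply: is_ideal_graded_le; exact: is_idealX.
move=> {mx}x y /mX1 mx my; split; first by rewrite -[i.+1]add1n; exact: idealXMM.
rewrite -[i.+1]add1n gr_classM // rmorphM; apply: idealX_prod; last exact: IHi.
by apply: (@hom_max_graded _ _ _ Agr 0); exact: u_graded.
Qed.

(** Since m^i consists of sums of [i]-fold products, [A] inherits from [gr] that its degree [i] part
    lies in the [i]-th power of [hom_max gA]; so the Loewy length bounds the degrees. *)
Lemma graded_eq0 d : idealX (hom_max gA) d.+1 = [set 0] ->
  forall i a, (d < i)%N -> gA i a -> a = 0.
Proof.
move=> hd [//|i] a di /u_lift[x [mx <- _]].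
by have /(idealX_anti di) := graded_hom_maxX mx; rewrite hd.
Qed.

(* A is generated in degree one, because gr is. *)
Lemma factor_generated_degree1 (K : set (gr m)) : is_ideal K ->
  (forall x, mX 1 x -> v (cl 1 x) = 0 -> K (cl 1 x)) ->
  forall g, hom_max gA (u g) -> v g = 0 -> K g.
Proof.
move=> IK K1.
have KX i x : mX i.+1 x -> v (cl i.+1 x) = 0 -> K (cl i.+1 x).
  case: i x => [//|i] x mx vx.
  (* The products that make up [x] may have nonzero [v]-part although [x] has none. So the induction
     produces some [g] in [K] with the right [u]-part, and [uv_inj] identifies it with the class of
     [x] only at the end. *)
  have : exists2 g, K g & u g = u (cl i.+2 x) /\ v g = 0.
    suff /(_ _ mx) [] : mX i.+2 `<=` [set x | mX i.+2 x /\
      exists2 g, K g & u g = u (cl i.+2 x) /\ v g = 0] by [].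
    have IX := is_idealX m i.+2.
    apply: idealM_le.
      split=> [|a b [ma [g Kg [ug vg]]] [mb [h Kh [uh vh]]]|a b [mb [h Kh [uh vh]]]].
      - split; first exact: is_ideal0 IX.
        by exists 0; [exact: is_ideal0 IK | rewrite gr_class0 !rmorph0].
      - split; first exact: is_idealD IX _ _.
        by exists (g + h); [exact: is_idealD IK _ _ |
          rewrite gr_classD // !rmorphD ug uh vg vh addr0].
      - split; first exact: is_idealMl IX _.
        have m0 : mX 0 a by [].
        exists (cl 0 a * h); first exact: is_idealMl IK _.
        by rewrite -[i.+2]add0n gr_classM // !rmorphM uh vh mulr0.
    move=> {mx vx} x y /mX1 mx my; split; first by rewrite -[i.+2]add1n; exact: idealXMM.
    have [x' [mx' ux' vx']] := split_left mx.
    exists (cl 1 x' * cl i.+1 y); first by apply: is_idealMr => //; exact: K1.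
    by rewrite -[i.+2]add1n gr_classM // !rmorphM ux' vx' mul0r.
  move=> [g Kg [ug vg]]; suff -> : cl i.+2 x = g by [].
  by apply/eqP; rewrite -subr_eq0; apply/eqP/uv_inj; rewrite rmorphB ?ug ?vg ?vx subrr.
move=> g [N [f [gf ugE]]] vg.
have /choice[x xE] : forall i, exists x,
    [/\ mX i.+1 x, u (cl i.+1 x) = f i & v (cl i.+1 x) = 0].
  by move=> i; exact: u_lift.
have -> : g = \sum_(i < N) cl i.+1 (x i).
  apply/eqP; rewrite -subr_eq0; apply/eqP/uv_inj; rewrite rmorphB rmorph_sum.
    by rewrite ugE -sumrB big1 // => i _; case: (xE i) => _ -> _; rewrite subrr.
  by rewrite vg /= big1 ?subrr // => i _; case: (xE i).
by apply: is_ideal_sum => // i _; case: (xE i) => mx _ vx; exact: KX.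
Qed.

End FactorOfGr.

(** * Local rings with nilpotent maximal ideal *)

Section NilpotentLocal.
Variables (R : comNzRingType) (m : idealr R) (F : fieldType) (p : {rmorphism R -> F}).
Variable s : nat.
Local Notation mX := (idealX m).
Hypothesis Rres : residue_field m p.
Hypothesis m_nilp : mX s.+1 = [set 0].

Lemma idealX_expr (I : set R) n x : I x -> idealX I n (x ^+ n).
Proof.
move=> Ix; elim: n => [//|n IHn]; rewrite exprS; exact: idealX_prod.
Qed.

(** With [y] a lift of the inverse residue, [1 - x * y] is nilpotent, and a finite geometric series
    inverts [x * y]. *)
Lemma unit_of_residue x : ~ (m : set R) x -> exists y, x * y = 1.
Proof.
case: Rres => psurj pker nmx.
have px : p x != 0 by apply/eqP => /pker.
have [y py] := psurj (p x)^-1.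
have mt : (m : set R) (1 - x * y).
  by apply/pker; rewrite rmorphB rmorph1 rmorphM py divff // subrr.
have := idealX_expr s.+1 mt; rewrite m_nilp /= => tn.
exists (y * \sum_(i < s.+1) (1 - x * y) ^+ i).
have := subrX1 (1 - x * y) s.+1; rewrite tn => /eqP.
rewrite -subr_eq0 => /eqP h; apply/eqP; rewrite -subr_eq0; apply/eqP.
apply: etrans h; ring.
Qed.

(** A coefficient of [w] either lies in m and kills [w] or is a unit, so every nonzero socle element
    generates the socle; m^s contains such an element. *)
Lemma local_socle (w : R) : quot_basis m (socle m) [set 0] (fun _ : 'I_1 => w) ->
  mX s <> [set 0] ->
  socle m = mX s /\
  forall t t', socle m t -> t <> 0 -> socle m t' -> exists q, t' = q * t.
Proof.
move=> [wS wgen wfree] ms0.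
have wE t : socle m t -> exists c, t = c * w.
  by move=> /wgen[c]; rewrite big_ord1 => /eqP; rewrite subr_eq0 => /eqP ->; exists (c ord0).
have gen t t' : socle m t -> t <> 0 -> socle m t' -> exists q, t' = q * t.
  move=> /wE[c ->] cw0 /wE[c' ->].
  have /unit_of_residue[d cd] : ~ (m : set R) c.
    by move=> mc; apply: cw0; rewrite mulrC; exact: (wS ord0).
  by exists (c' * d); rewrite -mulrA (mulrA d) (mulrC d) cd mul1r.
have mXs_soc : mX s `<=` socle m.
  move=> x mx y my; have : mX s.+1 (y * x) by exact: idealX_prod.
  by rewrite m_nilp mulrC.
split=> //; apply/seteqP; split=> // t' soct'.
have [t mt t0] : exists2 t, mX s t & t <> 0.
  apply: contrapT => nt; apply: ms0; apply/seteqP; split=> [x mx|_ ->] /=.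
    by apply: contrapT => x0; apply: nt; exists x.
  exact: is_ideal0 (is_idealX m s).
have [q ->] := gen _ _ (mXs_soc _ mt) t0 soct'.
exact: is_idealMl (is_idealX m s) mt.
Qed.

End NilpotentLocal.

(* Finite-dimensional duality: on a finitely generated ideal, a functional with
   values in a simple socle is multiplication by an element of D as soon as it
   vanishes wherever all of D does. *)
Lemma socle_functional_repr (R : comNzRingType) (S : set R) (l : seq R) (D : set R) x :
  is_ideal S -> (forall t t', S t -> t <> 0 -> S t' -> exists q, t' = q * t) ->
  is_ideal D -> (forall a u, D a -> seq_ideal l u -> S (a * u)) ->
  (forall u, seq_ideal l u -> S (x * u)) ->
  (forall u, seq_ideal l u -> (forall a, D a -> a * u = 0) -> x * u = 0) ->
  exists2 a, D a & forall u, seq_ideal l u -> a * u = x * u.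
Proof.
move=> IS Sgen; elim: l D x => [|v l IHl] D x ID DS xS Dx.
  exists 0; first exact: is_ideal0.
  move=> u lu; have -> : u = 0; last by rewrite !mulr0.
  exact: (ideal_gen_le (is_ideal_set0 R) _ lu).
have lv : seq_ideal (v :: l) v by apply: sub_ideal_gen; rewrite /= mem_head.
have Il : is_ideal (seq_ideal (v :: l)) by exact: is_ideal_gen.
have ll u : seq_ideal l u -> seq_ideal (v :: l) u.
  apply: ideal_gen_le => // {}u /= lu; apply: sub_ideal_gen.
  by rewrite /= inE lu orbT.
have [Dv|/existsNP[d /not_implyP[Dd dv]]] := pselect (forall d, D d -> d * v = 0).
  have xv : x * v = 0 by exact: Dx.
  have [||u /ll lu|a Da al] := IHl D x ID.
  - by move=> a u Da /ll lu; exact: DS.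
  - by move=> u /ll; exact: xS.
  - exact: Dx.
  exists a => // _ /seq_ideal_cons[c [w lw ->]].
  by rewrite !mulrDr (al w) // !(mulrCA _ c) xv Dv.
(* Subtracting [q * d] makes the functional vanish on [v]; the remaining correction must not disturb
   this and is therefore sought in [D']. *)
have [q xvE] := Sgen _ _ (DS _ _ Dd lv) dv (xS _ lv).
pose D' := [set a | D a /\ a * v = 0].
have ID' : is_ideal D'.
  split=> [|a b [Da av] [Db bv]|a b [Db bv]].
  - by split; [exact: is_ideal0 ID | rewrite mul0r].
  - by split; [exact: is_idealD ID _ _ | rewrite mulrDl av bv addr0].
  - by split; [exact: is_idealMl ID _ | rewrite -mulrA bv mulr0].
have [||u lu uD'|a [Da av] al] := IHl D' (x - q * d) ID'.
- by move=> a u [Da _] /ll lu; exact: DS.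
- move=> u /ll lu; rewrite mulrBl -mulrA.
  exact: is_idealB IS (xS _ lu) (is_idealMl _ IS (DS _ _ Dd lu)).
- have [e duE] := Sgen _ _ (DS _ _ Dd lv) dv (DS _ _ Dd (ll _ lu)).
  have lu' : seq_ideal (v :: l) (u - e * v).
    exact: is_idealB Il (ll _ lu) (is_idealMl _ Il lv).
  have Du' a : D a -> a * (u - e * v) = 0.
    move=> Da; have [g avE] := Sgen _ _ (DS _ _ Dd lv) dv (DS _ _ Da lv).
    have /uD' : D' (a - g * d).
      split; last by rewrite mulrBl avE -mulrA subrr.
      exact: is_idealB ID Da (is_idealMl _ ID Dd).
    rewrite mulrBl -mulrA duE => /eqP; rewrite subr_eq0 => /eqP auE.
    by rewrite mulrBr auE (mulrCA a) avE; ring.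
  have := Dx _ lu' Du'; rewrite mulrBr (mulrCA x) xvE => /eqP.
  rewrite subr_eq0 => /eqP xuE.
  by rewrite mulrBl xuE -mulrA duE; ring.
exists (a + q * d); first exact: is_idealD ID Da (is_idealMl _ ID Dd).
move=> _ /seq_ideal_cons[c [w lw ->]].
have := al _ lw; rewrite mulrBl => alE.
rewrite mulrDl !mulrDr !(mulrCA _ c) av alE xvE; ring.
Qed.

Lemma loewy_length_nilp (R : comNzRingType) (M : set R) n :
  loewy_length M n -> idealX M n.+1 = [set 0].
Proof. by move=> [_ h]; apply: contrapT => /h; rewrite ltnn. Qed.

(** * Orders and initial forms *)

Section InitialForm.
Variables (R : comNzRingType) (m : idealr R).

Lemma adic_order_unique i x :
  idealX m i x -> ~ idealX m i.+1 x -> adic_order m x = i.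
Proof.
move=> mx nmx; apply: xget_unique => // j [mjx nmjx].
case: (ltngtP i j) => // [ij|ji]; first by case: nmx; exact: idealX_anti ij _ mjx.
by case: nmjx; exact: idealX_anti ji _ mx.
Qed.

Lemma idealX_adic_order x : idealX m (adic_order m x) x.
Proof. by rewrite /adic_order; case: xgetP => [i _ []|]. Qed.

Lemma initial_form_graded i x : idealX m i x -> ~ idealX m i.+1 x ->
  initial_form m x = gr_class m i x.
Proof. by move=> mx nmx; rewrite /initial_form (adic_order_unique mx nmx). Qed.

End InitialForm.

(** * Associated graded rings that are fibre products *)

Section FibreIso.
Variables (R : comNzRingType) (m : idealr R) (F : fieldType).
Variables (A B : comAlgType F) (gA : nat -> set A) (gB : nat -> set B).
Variables (pA : {rmorphism A -> F}) (pB : {rmorphism B -> F}).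
Hypotheses (Agr : graded_algebra gA) (Bgr : graded_algebra gB).
Hypotheses (Aproj : natural_projection gA pA) (Bproj : natural_projection gB pB).
Variable phi : {rmorphism gr m -> fibre_prod pA pB}.
Hypothesis phi_iso : graded_iso (gr_comp m) (fibre_comp gA gB) phi.
Local Notation cl := (gr_class m).
Local Notation mX := (idealX m).

Definition gr_left (g : gr m) : A := (val (phi g)).1.
Definition gr_right (g : gr m) : B := (val (phi g)).2.

HB.instance Definition _ := GRing.RMorphism.copy gr_left
  ((@fst A B) \o (val \o phi)).
HB.instance Definition _ := GRing.RMorphism.copy gr_right
  ((@snd A B) \o (val \o phi)).

Lemma phi_surj a b : pA a = pB b -> exists g, gr_left g = a /\ gr_right g = b.
Proof.
move=> ab; have /eqP fab : pA a = pB b by [].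
case: phi_iso => -[psi _ psiK] _; exists (psi (@FibreProd _ _ _ pA pB (a, b) fab)).
by rewrite /gr_left /gr_right psiK.
Qed.

Lemma gr_left_right_inj g : gr_left g = 0 -> gr_right g = 0 -> g = 0.
Proof.
move=> ug vg; case: phi_iso => /bij_inj phi_inj _; apply: phi_inj; rewrite rmorph0.
apply: val_inj; rewrite rmorph0 [LHS]surjective_pairing.
by move: ug vg; rewrite /gr_left /gr_right => -> ->.
Qed.

Lemma gr_graded i x : mX i x -> gA i (gr_left (cl i x)) /\ gB i (gr_right (cl i x)).
Proof. by move=> mx; case: phi_iso => _ /(_ i (cl i x))[h _]; apply: h; exists x. Qed.

Lemma gr_lift i a b : gA i a -> gB i b -> pA a = pB b ->
  exists x, [/\ mX i x, gr_left (cl i x) = a & gr_right (cl i x) = b].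
Proof.
move=> ga gb /phi_surj[g [ug vg]].
case: phi_iso => _ /(_ i g)[_]; case; first by split; [rewrite -ug in ga | rewrite -vg in gb].
by move=> x mx xg; exists x; rewrite xg.
Qed.

Lemma gr_left_lift i a : gA i.+1 a ->
  exists x, [/\ mX i.+1 x, gr_left (cl i.+1 x) = a & gr_right (cl i.+1 x) = 0].
Proof.
move=> ga; apply: gr_lift => //; first exact: graded0.
by rewrite rmorph0; exact: proj_graded Aproj _ _ ga.
Qed.

Lemma gr_right_lift i b : gB i.+1 b ->
  exists x, [/\ mX i.+1 x, gr_right (cl i.+1 x) = b & gr_left (cl i.+1 x) = 0].
Proof.
move=> gb; have [||x [mx ux vx]] := @gr_lift i.+1 0 b _ gb; last by exists x.
  exact: graded0.
by rewrite rmorph0; apply/esym; exact: proj_graded Bproj _ _ gb.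
Qed.

Lemma gr_scalar_lift c : exists x, gr_left (cl 0 x) = c%:A.
Proof.
have [|x [_ ux _]] := gr_lift (graded_scalar Agr c) (graded_scalar Bgr c).
  by case: Aproj => -> _; case: Bproj => ->.
by exists x.
Qed.

Lemma preim_left_idealP g :
  (phi @^-1` left_ideal (hom_max gA)) g <-> hom_max gA (gr_left g) /\ gr_right g = 0.
Proof. by []. Qed.

Lemma preim_right_idealP g :
  (phi @^-1` right_ideal (hom_max gB)) g <-> gr_left g = 0 /\ hom_max gB (gr_right g).
Proof. by []. Qed.

Lemma is_ideal_preim_right : is_ideal (phi @^-1` right_ideal (hom_max gB)).
Proof.
have IB := is_ideal_hom_max Bgr.
split=> [|g h /preim_right_idealP[ug vg] /preim_right_idealP[uh vh]|g h /preim_right_idealP[uh vh]];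
  apply/preim_right_idealP.
- by rewrite !rmorph0; split => //; exact: is_ideal0 IB.
- rewrite !rmorphD /= ug uh addr0; split => //; exact: is_idealD IB _ _.
- rewrite !rmorphM /= uh mulr0; split => //; exact: is_idealMl IB _.
Qed.

(** Positive degrees project to zero, so the residue of an element of [gr] depends only on its
    constant coefficient. *)
Lemma gr_right_rees_class_proj P : P \in rees m -> (m : set R) P`_0 ->
  pB (gr_right (rees_class m P)) = 0.
Proof.
move=> RP mP0; rewrite rees_class_coef // rmorph_sum rmorph_sum big1 // => -[[|i] ltiP] _ /=.
  by rewrite ((gr_class_eq0 _).2 _) ?rmorph0 //; exact/mX1.
apply: (proj_graded Bgr Bproj (i := i)); have /reesP/(_ i.+1) := RP.
by case/gr_graded.
Qed.

End FibreIso.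

(** * Gorenstein rings whose associated graded ring is a fibre product *)

Section FibreProductGr.
Variables (Q : comNzRingType) (mQ : idealr Q).
Variables (F : fieldType) (pQ : {rmorphism Q -> F}) (s k : nat).
Hypotheses (QF : residue_field mQ pQ).
Hypotheses (Qgor : gorenstein_artinian mQ) (llQ : loewy_length mQ s).
Variables (A B : comAlgType F) (gA : nat -> set A) (gB : nat -> set B).
Variables (pA : {rmorphism A -> F}) (pB : {rmorphism B -> F}).
Hypotheses (Agr : graded_algebra gA) (Bgr : graded_algebra gB).
Hypotheses (Aproj : natural_projection gA pA) (Bproj : natural_projection gB pB).
Hypothesis Agor : gorenstein_artinian (hom_max gA).
Hypotheses (llA : loewy_length (hom_max gA) s) (llB : loewy_length (hom_max gB) k).
Hypotheses (k_ge1 : (1 <= k)%N) (s_gt : (k + 1 < s)%N).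
Variable phi : {rmorphism gr mQ -> fibre_prod pA pB}.
Hypothesis phi_iso : graded_iso (gr_comp mQ) (fibre_comp gA gB) phi.
Local Notation cl := (gr_class mQ).
Local Notation mX := (idealX mQ).
Local Notation u := (gr_left phi).
Local Notation v := (gr_right phi).
Local Notation ufree := (gr_left_right_inj phi_iso).

Let mX_nilp : mX s.+1 = [set 0].
Proof. exact: loewy_length_nilp llQ. Qed.

Let IX i : is_ideal (mX i).
Proof. exact: is_idealX. Qed.

Let u_graded i x : mX i x -> gA i (u (cl i x)).
Proof. by case/(gr_graded phi_iso). Qed.

Let v_graded i x : mX i x -> gB i (v (cl i x)).
Proof. by case/(gr_graded phi_iso). Qed.

Let u_lift i a : gA i.+1 a ->
  exists x, [/\ mX i.+1 x, u (cl i.+1 x) = a & v (cl i.+1 x) = 0].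
Proof. exact: (gr_left_lift Agr Bgr Aproj phi_iso). Qed.

Let v_lift i b : gB i.+1 b ->
  exists x, [/\ mX i.+1 x, v (cl i.+1 x) = b & u (cl i.+1 x) = 0].
Proof. exact: (gr_right_lift Agr Bgr Bproj phi_iso). Qed.

Let vu_inj g : v g = 0 -> u g = 0 -> g = 0.
Proof. by move=> vg ug; exact: ufree. Qed.

Lemma gradedA_top i a : (s < i)%N -> gA i a -> a = 0.
Proof. exact: (graded_eq0 Agr u_graded u_lift (loewy_length_nilp llA)). Qed.

Lemma gradedB_top i b : (k < i)%N -> gB i b -> b = 0.
Proof. exact: (graded_eq0 Bgr v_graded v_lift (loewy_length_nilp llB)). Qed.

Lemma gr_right_top i x : (k < i)%N -> mX i x -> v (cl i x) = 0.
Proof. by move=> ki /v_graded; exact: gradedB_top. Qed.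

Lemma gradedB_topN0 : exists2 b, gB k b & b <> 0.
Proof.
case: llB => /(hom_maxX_neq0 Bgr)[i ki [b gb b0]] _.
have -> : k = i; last by exists b.
by apply/eqP; rewrite eqn_leq ki leqNgt; apply/negP => /gradedB_top /(_ gb).
Qed.

(** The pairing of [A] lifts to Q, since a product with nonzero class is nonzero. *)
Lemma gr_left_pairing i x : (i <= s)%N -> mX i x -> u (cl i x) <> 0 ->
  exists2 y, mX (s - i) y & x * y <> 0.
Proof.
move=> le_is mx ux; case: llA => /(hom_maxX_neq0 Agr)[d sd [t gt t0]] _.
have sE : s = d.
  by apply/eqP; rewrite eqn_leq sd leqNgt; apply/negP => /gradedA_top /(_ gt).
rewrite -{}sE in gt.
have [b gb ab0] := gorenstein_graded_pairing Agr Aproj Agor gt t0 gradedA_top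
  le_is (u_graded mx) ux.
have [y my uy] : exists2 y, mX (s - i) y & u (cl (s - i) y) = b.
  (* When [i = s] the partner is a scalar, which must be lifted together with the same scalar of
     [B]. *)
  case: (s - i)%N gb => [|j] gb.
    have [c _ <-] : range (fun c : F => c%:A) b by case: Agr => <-.
    by have [y uy] := gr_scalar_lift Agr Bgr Aproj Bproj phi_iso c; exists y.
  by have [y [my uy _]] := u_lift gb; exists y.
exists y => // xy0; apply: ab0; rewrite -uy -rmorphM -gr_classM //.
by rewrite xy0 gr_class0 rmorph0.
Qed.

(** Otherwise the partner of [x] under the pairing, which lies in m^(s-i) and hence in m^j, would
    not be killed by [x]. *)
Lemma gr_left_ann i j x : (i + j <= s)%N -> mX i x -> ann (mX j) x ->
  u (cl i x) = 0.
Proof.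
move=> ij mx xj; apply: contrapT => ux.
have [|y my] := gr_left_pairing _ mx ux; first by rewrite (leq_trans _ ij) ?leq_addr.
apply; apply: xj; apply: idealX_anti my.
by rewrite leq_subRL // (leq_trans _ ij) // leq_addr.
Qed.

Lemma ann_sub_max j x : (j <= s)%N -> ann (mX j) x -> (mQ : set Q) x.
Proof.
move=> js xj; apply: contrapT => /(unit_of_residue QF mX_nilp)[y xy].
case: llQ => + _; apply; apply/seteqP; split=> [t /(idealX_anti js) mt|_ ->] /=.
  by rewrite -[t]mulr1 -xy mulrA (mulrC t) xj // mul0r.
exact: is_ideal0 (IX s).
Qed.

Lemma mX_gr_eq0 i x : mX i x -> u (cl i x) = 0 -> v (cl i x) = 0 -> mX i.+1 x.
Proof. by move=> mx ux vx; apply/gr_class_eq0 => //; exact: ufree. Qed.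

(** * Lifts of generators of the left factor *)

Section LeftGenerators.
Variables (m : nat) (y : 'I_m -> Q).
Hypothesis ygen : minimally_generates (fun i => initial_form mQ (y i))
     (phi @^-1` left_ideal (hom_max gA)).

Let ystar j : hom_max gA (u (initial_form mQ (y j))) /\ v (initial_form mQ (y j)) = 0.
Proof.
have := @mem_ideal_gen_range _ _ (fun j => initial_form mQ (y j)) j.
by case: (ygen) => -> _.
Qed.

Lemma left_gens_max j : (mQ : set Q) (y j).
Proof.
apply: contrapT => my; have [x yx] := unit_of_residue QF mX_nilp my.
have [+ _] := ystar j; rewrite (@initial_form_graded _ _ 0) //; last by move/mX1.
move=> uy; have : pA (u (cl 0 (y j))) = 0 by case: Aproj => _ /(_ (u (cl 0 (y j))))[_]; exact.
move=> pu0; have : pA (u (cl 0 (y j * x))) = 0.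
  by rewrite (@gr_classM _ _ 0 0) // !rmorphM pu0 mul0r.
by rewrite yx gr_class01 !rmorph1 => /eqP; rewrite oner_eq0.
Qed.

Let my1 j : mX 1 (y j).
Proof. by apply/mX1; exact: left_gens_max. Qed.

Lemma left_gens_initial_form j : ~ mX 2 (y j) -> initial_form mQ (y j) = cl 1 (y j).
Proof. exact: initial_form_graded. Qed.

Lemma left_gens_gr_right j : v (cl 1 (y j)) = 0.
Proof.
have [my|my] := pselect (mX 2 (y j)); first by rewrite ((gr_class_eq0 (my1 j)).2 my) rmorph0.
by rewrite -left_gens_initial_form //; case: (ystar j).
Qed.

Lemma left_gens_span x : mX 1 x -> v (cl 1 x) = 0 ->
  exists c, mX 2 (x - \sum_j c j * y j).
Proof.
move=> mx vx; have : (phi @^-1` left_ideal (hom_max gA)) (cl 1 x).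
  apply/preim_left_idealP; split=> //; apply: (hom_max_graded Agr (i := 0)).
  exact: u_graded.
case: ygen => <- _ /ideal_gen_rangeP[e clx].
have /choice[P PE] : forall j, exists P, P \in rees mQ /\ e j = rees_class mQ P.
  by move=> j; have [P RP ->] := rees_class_surj (e j); exists P.
have := @gr_class1_combination _ mQ _ P (fun j => adic_order mQ (y j)) y x.
move=> /(_ (fun j => (PE j).1) (fun j => idealX_adic_order _ _) mx) h.
(* Generators of order above one receive coefficient zero, as they are invisible in degree one. *)
exists (fun j => if (adic_order mQ (y j) <= 1)%N then (P j)`_(1 - adic_order mQ (y j)) else 0).
rewrite -opprB; apply: is_idealN (IX 2) _; rewrite [X in X - _](_ : _ =
   \sum_(j | (adic_order mQ (y j) <= 1)%N) (P j)`_(1 - adic_order mQ (y j)) * y j).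
  by apply: h; rewrite clx; apply: eq_bigr => j _; rewrite -(PE j).2.
by rewrite [RHS]big_mkcond; apply: eq_bigr => j _; case: ifP; rewrite ?mul0r.
Qed.

(** If [c i] were a unit, [y i] could be eliminated modulo m^2. The other initial forms would then
    generate the degree-one part of [A], hence its whole maximal ideal, against minimality. *)
Lemma left_gens_indep c : mX 2 (\sum_j c j * y j) -> forall i, (mQ : set Q) (c i).
Proof.
move=> mc i; apply: contrapT => /(unit_of_residue QF mX_nilp)[d cd].
case: ygen => yg /(_ i); apply; apply/seteqP; split.
  rewrite -yg; apply: ideal_gen_le => [|_ [j _ <-]]; first exact: is_ideal_gen.
  exact: (@mem_ideal_gen_range _ _ (fun j => initial_form mQ (y j)) j).
move=> g /preim_left_idealP[ug vg]; have IK := is_ideal_gen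
  ((fun j => initial_form mQ (y j)) @` [set j | j != i]).
apply: (factor_generated_degree1 ufree u_graded u_lift IK) => // x mx vx.
have [a ma] := left_gens_span mx vx.
have mx' : mX 2 (x - \sum_(j | j != i) (a j - a i * d * c j) * y j).
  have := is_idealD (IX 2) ma (is_idealMl (a i * d) (IX 2) mc).
  set t := _ + _; suff -> : t = x - \sum_(j | j != i) (a j - a i * d * c j) * y j by [].
  rewrite {}/t.
  rewrite (bigD1 i) //= [X in a i * d * X](bigD1 i) //= !mulrDr !mulr_sumr.
  under [in RHS]eq_bigr do rewrite mulrBl -[X in _ - X]mulrA.
  rewrite sumrB; have -> : a i * d * (c i * y i) = a i * y i.
    by rewrite (mulrC (a i)) -mulrA (mulrCA (a i)) (mulrA d) (mulrC d) cd mul1r.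
  by ring.
have mq j : mX 1 ((a j - a i * d * c j) * y j) by exact: is_idealMl (IX 1) _.
have -> : cl 1 x = \sum_(j | j != i) cl 0 (a j - a i * d * c j) * cl 1 (y j).
  apply/eqP; rewrite -subr_eq0; apply/eqP.
  under eq_bigr do rewrite -gr_classM //.
  rewrite -gr_class_sum // -gr_classB //; last exact: is_ideal_sum (IX 1) _.
  by apply/gr_class_eq0 => //; exact: idealXSS.
apply: (is_ideal_sum _ IK) => j ji; apply: (is_idealMl _ IK).
have [my|my] := pselect (mX 2 (y j)).
  by rewrite ((gr_class_eq0 (my1 j)).2 my); exact: is_ideal0 IK.
by rewrite -left_gens_initial_form //; apply: sub_ideal_gen; exists j.
Qed.

End LeftGenerators.

(** * Generators of both factors and their products *)

Section Generators.
Variables (m : nat) (y : 'I_m -> Q).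
Hypothesis ygen : minimally_generates (fun i => initial_form mQ (y i))
     (phi @^-1` left_ideal (hom_max gA)).
Variables (n : nat) (z : 'I_n -> Q).
Local Notation I := (ideal_gen (range y)).
Local Notation J := (ideal_gen (range z)).
Hypothesis Jann : J `<=` ann (mX (k + 1)).
Hypothesis zbasis : quot_basis mQ (idealD (ann (mX (k + 1))) (mX 2)) (mX 2) z.

Let II : is_ideal I.
Proof. exact: is_ideal_gen. Qed.

Let IJ : is_ideal J.
Proof. exact: is_ideal_gen. Qed.

Let ImQ : is_ideal mQ.
Proof. exact: is_ideal_idealr. Qed.

Lemma sub_left_gens_max : I `<=` mQ.
Proof. by apply: ideal_gen_range_le => // j; exact: left_gens_max ygen _. Qed.

Lemma left_ideal_mod2 x : mX 1 x -> v (cl 1 x) = 0 -> idealD I (mX 2) x.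
Proof.
move=> mx vx; have [c mc] := left_gens_span ygen mx vx.
exists (\sum_j c j * y j); first by apply/ideal_gen_rangeP; exists c.
by exists (x - \sum_j c j * y j) => //; rewrite addrC subrK.
Qed.

Lemma sub_left_gens_gr_right x : I x -> v (cl 1 x) = 0.
Proof.
suff /[apply] -[] : I `<=` [set x | mX 1 x /\ [set 0] (v (cl 1 x))] by [].
apply: ideal_gen_range_le => [|j].
  by apply: is_ideal_graded_le; exact: is_ideal_set0.
split; first by apply/mX1; exact: left_gens_max ygen _.
exact: left_gens_gr_right ygen _.
Qed.

(** Above degree [k] there is no B-part, so [power_lift] approximates m^j by I^j modulo m^(j+1); the
    errors are pushed up until they reach m^(s+1) = 0. *)
Lemma idealX_top i : (k < i)%N -> mX i = idealX I i.
Proof.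
move=> ki; have IIX := is_idealX I i.
have IXm j : idealX I j `<=` mX j by apply: idealX_le; exact: sub_left_gens_max.
have step j : (i <= j)%N -> mX j `<=` idealD (idealX I j) (mX j.+1).
  move=> ij x mx; have [x' [Ix' ux' vx']] :=
    power_lift u_graded u_lift II sub_left_gens_max left_ideal_mod2 mx.
  exists x' => //; exists (x - x'); last by rewrite addrC subrK.
  apply: (gr_class_eq ufree) => //; first exact: IXm.
  have kj := leq_trans ki ij; rewrite vx' ?(leq_ltn_trans _ kj) //.
  exact: (gr_right_top kj mx).
apply/seteqP; split; last exact: IXm.
have all d x : mX i x -> idealD (idealX I i) (mX (i + d)) x.
  move=> mx; elim: d => [|d [a Ia [b mb <-]]].
    by rewrite addn0; apply: sub_idealDr.
  have [a' Ia' [b' mb' <-]] := step _ (leq_addr d i) _ mb.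
  exists (a + a'); last by exists b'; [rewrite addnS | rewrite addrA].
  by apply: is_idealD => //; apply: idealX_anti Ia'; rewrite leq_addr.
move=> x /(all s.+1)[a Ia [b mb <-]].
have : mX s.+1 b by apply: idealX_anti mb; rewrite leq_addl.
by rewrite mX_nilp => ->; rewrite addr0.
Qed.

Lemma idealX_top_fg i : (k < i)%N -> exists l, mX i = seq_ideal l.
Proof. by move=> /idealX_top ->; rewrite seq_ideal_range; exact: idealX_seq_ideal. Qed.

Lemma right_part_annihilates i x : mX 1 x -> u (cl 1 x) = 0 -> (k < i < s)%N ->
  exists2 x', mX 2 x' & forall t, mX i t -> (x - x') * t = 0.
Proof.
move=> mx ux; have [_ [w wB]] := Qgor.
have [socE socgen] := local_socle QF mX_nilp wB llQ.1.
have [d] := ubnP (s - i); elim: d i => // d IHd i lt_d /andP[ki lt_is].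
have [i1s|i1s] := eqVneq i.+1 s.
  exists 0; first exact: is_ideal0 (IX 2).
  move=> t mt; rewrite subr0.
  have mxt : mX s (x * t) by rewrite -i1s -add1n; exact: idealXMM.
  have : mX s.+1 (x * t).
    by apply: mX_gr_eq0 => //; rewrite -{1}i1s -add1n gr_classM // rmorphM /= ?ux ?mul0r //
      (gr_right_top ki) // mulr0.
  by rewrite mX_nilp.
have [||x' mx' xx'] := IHd i.+1.
- by rewrite subnS; case: (s - i)%N lt_d (subn_gt0 i s) => [|e]; rewrite ?lt_is.
- by rewrite (ltn_trans ki) //= ltn_neqAle i1s.
have [l lE] := idealX_top_fg ki.
(* As [x - x'] kills m^(i+1), it maps m^i into the socle. An element of m^i killed by m^(s-i) has no
   A-part by the pairing and no B-part as i > k, so it lies in m^(i+1), where [x - x'] vanishes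
   too. *)
have [||||||a ma xa] := @socle_functional_repr Q (socle mQ) l (mX (s - i)) (x - x').
- exact: is_ideal_ann.
- exact: socgen.
- exact: IX.
- move=> a t ma; rewrite -lE socE => mt; rewrite -(subnK (ltnW lt_is)).
  exact: idealXMM.
- move=> t; rewrite -lE => mt b mb; rewrite -mulrA xx' //.
  by rewrite mulrC; exact: idealX_prod.
- move=> t; rewrite -lE => mt at0; apply: xx'.
  apply: mX_gr_eq0 => //; last exact: gr_right_top.
  apply: contrapT => ut; have [b mb] := gr_left_pairing (ltnW lt_is) mt ut.
  by rewrite mulrC at0.
(* Here s - i is at least 2, so the correction stays in m^2; this is why i + 1 = s is treated
   apart. *)
exists (x' + a).
  apply: is_idealD (IX 2) mx' _; apply: idealX_anti ma.
  by rewrite leq_subRL ?(ltnW lt_is) // addn2 ltn_neqAle i1s.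
by move=> t; rewrite lE => /xa h; rewrite opprD addrA mulrBl h subrr.
Qed.

Lemma right_ideal_mod2 x : mX 1 x -> u (cl 1 x) = 0 -> idealD J (mX 2) x.
Proof.
move=> mx ux; have [|x' mx' xx'] := right_part_annihilates (i := k + 1) mx ux.
  by rewrite s_gt addn1 leqnn.
case: zbasis => _ /(_ x) + _; case.
  by exists (x - x') => //; exists x' => //; rewrite subrK.
move=> c mc; exists (\sum_i c i * z i); first by apply/ideal_gen_rangeP; exists c.
by exists (x - \sum_i c i * z i) => //; rewrite addrC subrK.
Qed.

Lemma sub_right_gens_max : J `<=` mQ.
Proof. by move=> x /Jann; apply: ann_sub_max; exact: ltnW. Qed.

Let mXJ x : J x -> mX 1 x.
Proof. by move=> /sub_right_gens_max; exact: (mX1 _ _).2. Qed.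

Lemma sub_right_gens_gr_left x : J x -> u (cl 1 x) = 0.
Proof.
move=> Jx; apply: (@gr_left_ann 1 (k + 1)); [by rewrite add1n|exact: mXJ|exact: Jann].
Qed.

Let Jz i : J (z i).
Proof. exact: mem_ideal_gen_range. Qed.

Lemma right_gens_indep c : mX 2 (\sum_i c i * z i) -> forall i, (mQ : set Q) (c i).
Proof. by case: zbasis => _ _; exact. Qed.

Lemma right_gens_initial_form i : initial_form mQ (z i) = cl 1 (z i).
Proof.
apply: initial_form_graded; first exact: mXJ.
move=> mz; have : (mQ : set Q) 1.
  have := @right_gens_indep (fun j => (j == i)%:R) _ i; rewrite eqxx; apply.
  rewrite (bigD1 i) //= eqxx mul1r big1 ?addr0 // => j /negPf ->.
  by rewrite mul0r.
by rewrite /ideal_set /= idealr1.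
Qed.

(** The combination of the [z j] has no A-part and that of the [y i] no B-part, so each lies in m^2
    separately. *)
Lemma gens_indep c d : mX 2 (\sum_i c i * y i + \sum_j d j * z j) ->
  (forall i, (mQ : set Q) (c i)) /\ forall j, (mQ : set Q) (d j).
Proof.
set a := \sum_i _; set b := \sum_j _ => mab.
have Ia : I a by apply/ideal_gen_rangeP; exists c.
have Jb : J b by apply/ideal_gen_rangeP; exists d.
have ma : mX 1 a by apply/mX1; exact: sub_left_gens_max.
have mb := mXJ Jb.
have m2a : mX 2 a.
  apply: mX_gr_eq0 => //; last exact: sub_left_gens_gr_right.
  have : u (cl 1 (a + b)) = 0.
    by rewrite ((gr_class_eq0 _).2 mab) ?rmorph0 //; exact: is_idealD (IX 1) _ _.
  by rewrite gr_classD // rmorphD /= (sub_right_gens_gr_left Jb) addr0.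
split; first exact: left_gens_indep ygen _ m2a.
apply: right_gens_indep; rewrite -/b -[b](addKr a) addrC.
exact: is_idealB (IX 2) mab m2a.
Qed.

Lemma gr_right_indep : indep_mod_ker (pB \o v) (fun i => initial_form mQ (z i)).
Proof.
move=> e e0; have /choice[P PE] : forall i, exists P, P \in rees mQ /\ e i = rees_class mQ P.
  by move=> i; have [P RP ->] := rees_class_surj (e i); exists P.
have := @gr_class1_combination _ mQ _ P (fun=> 1%N) z 0.
move=> /(_ (fun i => (PE i).1) (fun i => mXJ (Jz i)) (is_ideal0 (IX 1))).
rewrite gr_class0 subr0 => h; have := right_gens_indep (h _) => {}h i /=.
rewrite (PE i).2; apply: (gr_right_rees_class_proj Bgr Bproj phi_iso (PE i).1).
apply: h; rewrite -[RHS]e0; apply: eq_bigr => j _.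
by rewrite -(PE j).2 right_gens_initial_form.
Qed.

Lemma right_gens_gr :
  ideal_gen (range (fun i => initial_form mQ (z i))) =
  phi @^-1` right_ideal (hom_max gB).
Proof.
apply/seteqP; split.
  apply: ideal_gen_range_le => [|i].
    exact: (is_ideal_preim_right Bgr phi).
  rewrite right_gens_initial_form; apply/preim_right_idealP; split.
    exact: sub_right_gens_gr_left.
  by apply: (hom_max_graded Bgr (i := 0)); apply: v_graded; exact: mXJ.
move=> g /preim_right_idealP[ug vg]; have IK := is_ideal_gen
  (range (fun i => initial_form mQ (z i))).
apply: (factor_generated_degree1 vu_inj v_graded v_lift IK) => // x mx ux.
have [_ /ideal_gen_rangeP[c ->] [t mt <-]] := right_ideal_mod2 mx ux.
have mz i : mX 1 (c i * z i) by exact: is_idealMl (IX 1) (mXJ (Jz i)).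
rewrite gr_classD; [|exact: is_ideal_sum (IX 1) _|exact: idealXSS].
rewrite ((gr_class_eq0 (idealXSS mt)).2 mt) addr0 gr_class_sum //.
apply: (is_ideal_sum _ IK) => i _; rewrite -[1%N]add0n gr_classM //; last exact: mXJ.
apply: (is_idealMl _ IK); rewrite -right_gens_initial_form.
exact: (@mem_ideal_gen_range _ _ (fun i => initial_form mQ (z i))).
Qed.

Lemma right_gens_min_num : min_num_gens J n.
Proof.
split=> [|q w wJ]; first by exists z.
apply: (indep_leq_gens (p := pQ) _ wJ) => e e0 i.
apply/(QF.2 (e i)); apply: right_gens_indep; rewrite e0; exact: is_ideal0 (IX 2).
Qed.

Lemma embdim_right : embdim (hom_max gB) n.
Proof.
pose x i := v (initial_form mQ (z i)).
have xgen : ideal_gen (range x) = hom_max gB.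
  apply/seteqP; split.
    apply: ideal_gen_range_le => [|i]; first exact: is_ideal_hom_max Bgr.
    have := @mem_ideal_gen_range _ _ (fun i => initial_form mQ (z i)) i.
    by rewrite right_gens_gr => /preim_right_idealP[].
  move=> b bm; have [|g [ug vg]] := phi_surj phi_iso (a := 0) (b := b).
    by rewrite rmorph0; case: Bproj => _ /(_ b)[_ ->].
  have : (phi @^-1` right_ideal (hom_max gB)) g by apply/preim_right_idealP; rewrite vg.
  rewrite -right_gens_gr => /ideal_gen_rangeP[e gE].
  apply/ideal_gen_rangeP; exists (fun i => v (e i)).
  by rewrite -vg gE rmorph_sum; apply: eq_bigr => i _; rewrite rmorphM.
split=> [|q w wB]; first by exists x.
rewrite -xgen in wB; apply: (indep_leq_gens (p := pB) _ wB) => e e0 i.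
(* A relation in [B] is lifted to [gr] by giving each coefficient the scalar A-part with the same
   residue; the A-part of the relation vanishes because the initial forms of the [z j] have none. *)
have /choice[g gE] : forall j, exists g, u g = (pB (e j))%:A /\ v g = e j.
  by move=> j; apply: (phi_surj phi_iso); case: Aproj => ->.
have := gr_right_indep (e := g) _ i; rewrite /= (gE i).2; apply.
apply: ufree.
  rewrite rmorph_sum big1 // => j _; rewrite rmorphM /= right_gens_initial_form.
  by rewrite sub_right_gens_gr_left ?mulr0.
by rewrite rmorph_sum -[RHS]e0; apply: eq_bigr => j _; rewrite rmorphM /= (gE j).2.
Qed.

Lemma right_gens_mod2 : idealD J (mX 2) = ann (mX (s - 1)).
Proof.
have s1 : (k + 1 <= s - 1)%N by rewrite leq_subRL ?add1n // (leq_trans _ s_gt).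
have s0 : (0 < s)%N by exact: leq_trans s_gt.
apply/seteqP; split.
  apply: idealD_le => [|x Jx t /(idealX_anti s1)|x mx t mt].
  - exact: is_ideal_ann.
  - exact: Jann.
  - have : mX s.+1 (x * t) by apply: idealX_mul_le mx mt; rewrite addnBA // addSn subn1.
    by rewrite mX_nilp.
move=> x xa; have mx : mX 1 x by apply/mX1; apply: ann_sub_max xa; exact: leq_subr.
apply: right_ideal_mod2 => //; apply: gr_left_ann xa => //.
by rewrite subnKC.
Qed.

(** For [k = 1] the ideal J kills m^2, so the m^2 summand of the previous lemma lies in [ann J]. *)
Lemma ann_sub_right_gens : k = 1%N -> ann (mX (s - 1)) `<=` idealD J (ann J).
Proof.
move=> k1; rewrite -right_gens_mod2 => _ [a Ja [b mb <-]].
exists a => //; exists b => // t Jt; rewrite mulrC; apply: (Jann Jt).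
by rewrite k1.
Qed.

(** By Nakayama it suffices to work modulo m^2, where I supplies the A-part of an element and J the
    remainder. *)
Lemma max_eq_gens : (mQ : set Q) = idealD I J.
Proof.
have ID : is_ideal (idealD I J) by exact: is_ideal_idealD.
apply/seteqP; split; last first.
  by apply: idealD_le => //; [exact: sub_left_gens_max | exact: sub_right_gens_max].
apply: (nilpotent_nakayama ImQ ID mX_nilp) => x /mX1 mx.
have [x' [mx' ux' vx']] := split_left u_graded u_lift mx.
have IDX : is_ideal (idealD (idealD I J) (mX 2)) by exact: is_ideal_idealD.
rewrite -(subrK x' x); apply: is_idealD => //.
  have mxx' : mX 1 (x - x') by exact: is_idealB (IX 1) _ _.
  have [|a Ja [b mb <-]] := right_ideal_mod2 mxx'.
    by rewrite gr_classB // rmorphB /= ux' subrr.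
  by exists a; [exact: sub_idealDr | exists b].
have [a Ia [b mb <-]] := left_ideal_mod2 mx' vx'.
by exists a; [exact: sub_idealDl | exists b].
Qed.

Lemma max_minimally_generated : minimally_generates
  (fun i : 'I_m + 'I_n => match i with inl a => y a | inr b => z b end) mQ.
Proof.
apply: (indep_minimally_generates (p := pQ)).
  move=> e; rewrite big_sumType /= => e0.
  have [|eI eJ] := gens_indep (c := e \o inl) (d := e \o inr).
    by rewrite /= e0; exact: is_ideal0 (IX 2).
  by case=> i; apply/(QF.2 _); [exact: eI | exact: eJ].
rewrite max_eq_gens; set yz := (fun i => _); apply/seteqP; split.
  apply: ideal_gen_range_le => [|[i|i]]; first exact: is_ideal_idealD.
    by apply: sub_idealDl => //; exact: mem_ideal_gen_range.
  by apply: sub_idealDr => //; exact: mem_ideal_gen_range.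
have Iyz : is_ideal (ideal_gen (range yz)) by exact: is_ideal_gen.
apply: idealD_le => //; apply: ideal_gen_range_le => // i.
  exact: (@mem_ideal_gen_range _ _ yz (inl i)).
exact: (@mem_ideal_gen_range _ _ yz (inr i)).
Qed.

(** A nonzero element of B_k has a representative in J^k, and its nonzero class keeps that
    representative out of m^(k+1). *)
Lemma right_power_order : exists2 x, idealX J k x & ~ mX k.+1 x.
Proof.
have [b gb b0] := gradedB_topN0.
have [x mx vx] : exists2 x, mX k x & v (cl k x) = b.
  by case: k k_ge1 gb => // j _ gb; have [x [mx vx _]] := v_lift gb; exists x.
have [x' [Jx' vx' _]] := power_lift v_graded v_lift IJ sub_right_gens_max right_ideal_mod2 mx.
exists x' => //; move=> /gr_class_eq0 h; apply: b0.
rewrite -vx -vx' h ?rmorph0 //; apply: idealX_le Jx'; exact: sub_right_gens_max.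
Qed.

Lemma right_gens_socle : idealM J (mX k) = socle mQ.
Proof.
have [_ [w wB]] := Qgor; have [socE socgen] := local_socle QF mX_nilp wB llQ.1.
have Jsoc : idealM J (mX k) `<=` socle mQ.
  apply: idealM_le => [|x t Jx mt a ma]; first exact: is_ideal_ann.
  by rewrite -mulrA; apply: (Jann Jx); rewrite addn1 mulrC; exact: idealX_prod.
apply/seteqP; split => // t soct.
(* One nonzero element suffices, since it generates the socle. *)
have [[r Jr r0]|h] := pselect (exists2 r, idealM J (mX k) r & r <> 0).
  have [q ->] := socgen _ _ (Jsoc _ Jr) r0 soct.
  exact: is_idealMl (is_ideal_idealM _ _) Jr.
have [x Jx []] := right_power_order.
have : socle mQ x.
  move=> a ma; apply: contrapT => xa0; apply: h; exists (x * a) => //.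
  case: k k_ge1 Jx => // j _.
  suff /[apply] : idealX J j.+1 `<=` [set x | idealM J (mX j.+1) (x * a)] by [].
  apply: idealM_le.
    have IM := is_ideal_idealM J (mX j.+1).
    split=> [|b c Jb Jc|b c Jc] /=; rewrite ?mul0r ?mulrDl -?mulrA.
    - exact: is_ideal0 IM.
    - exact: is_idealD IM _ _.
    - exact: is_idealMl IM _.
  move=> b c Jb Jc /=; rewrite -mulrA; apply: idealM_mem => //.
  rewrite mulrC; apply: idealX_prod => //.
  by apply: idealX_le Jc; exact: sub_right_gens_max.
by rewrite socE => /(@idealX_anti _ _ k.+1); apply; rewrite -addn1 ltnW.
Qed.

Lemma right_powerN0 : idealX J k <> [set 0].
Proof.
have [x Jx nx] := right_power_order => J0; apply: nx.
by move: Jx; rewrite J0 => ->; exact: is_ideal0 (IX k.+1).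
Qed.

(** The two factors annihilate each other in positive degrees, so the class of the product in degree
    two is zero. *)
Lemma left_right_mul3 x t : I x -> J t -> mX 3 (x * t).
Proof.
move=> Ix Jt; have mx : mX 1 x by apply/mX1; exact: sub_left_gens_max.
have mt := mXJ Jt.
apply: mX_gr_eq0; first exact: (@idealXMM _ _ 1 1).
  by rewrite (@gr_classM _ _ 1 1) // rmorphM /= (sub_right_gens_gr_left Jt) mulr0.
by rewrite (@gr_classM _ _ 1 1) // rmorphM /= (sub_left_gens_gr_right Ix) mul0r.
Qed.

Lemma left_right_products_socle :
  idealD (idealM (idealX I k) J) (idealX J (k + 1)) `<=` socle mQ.
Proof.
rewrite -right_gens_socle.
apply: idealD_le => [||]; first exact: is_ideal_idealM.
  apply: idealM_le => [|x t Ix Jt]; first exact: is_ideal_idealM.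
  rewrite mulrC; apply: idealM_mem => //.
  by apply: idealX_le Ix; exact: sub_left_gens_max.
rewrite addn1; apply: idealM_le => [|x t Jx Jt]; first exact: is_ideal_idealM.
apply: idealM_mem => //.
by apply: idealX_le Jt; exact: sub_right_gens_max.
Qed.

Lemma right_power_ann b : (b <= k + 1)%N -> idealX J b.+1 `<=` ann (mX (k + 1 - b)).
Proof.
move=> bk; apply: idealM_le => [|x t Jx Jt r mr]; first exact: is_ideal_ann.
rewrite -mulrA; apply: (Jann Jx); rewrite -(subnKC bk); apply: idealXMM => //.
by apply: idealX_le Jt; exact: sub_right_gens_max.
Qed.

(** As [b <= k], some factor from I is present; joined with one from J it gains a degree by
    [left_right_mul3]. As [2 <= b], a further factor from J remains to annihilate the result. *)
Lemma left_right_products_eq0 a b : (a + b = k + 1)%N -> (2 <= b <= k)%N ->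
  idealM (idealX I a) (idealX J b) = [set 0].
Proof.
case: a => [|a]; first by rewrite add0n addn1 => -> /andP[_]; rewrite ltnn.
case: b => [|[|b]] // abk _; apply/seteqP; split; last first.
  by move=> _ ->; exact: is_ideal0 (is_ideal_idealM _ _).
have Iann (r : Q) : is_ideal [set x | x * r = 0].
  split=> [|x1 x2 /= h1 h2|c x1 /= h1]; first exact: mul0r.
    by rewrite mulrDl h1 h2 addr0.
  by rewrite -mulrA h1 mulr0.
apply: idealM_le => [|x t Ix Jt]; first exact: is_ideal_set0.
apply: (@idealM_le _ I (idealX I a) [set x | x * t = 0] _ _ x Ix) => // {Ix}x x' Ix Ix'.
rewrite /= mulrC.
apply: (@idealM_le _ J (idealX J b.+1) [set t | t * (x * x') = 0] _ _ t Jt) => //.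
move=> {Jt}t t' Jt Jt' /=.
(* After the case splits the original exponents are [a.+1] and [b.+2], so [k + 1 - b] equals
   [a + 3]. *)
have mxtx' : mX (k + 1 - b) (x * t * x').
  have mx' : mX a x' by apply: idealX_le Ix'; exact: sub_left_gens_max.
  apply: idealX_mul_le (left_right_mul3 Ix Jt) mx'.
  by rewrite -abk !addSn !addnS -!addSn addnK addnC !addnS addn0.
have bk : (b <= k + 1)%N by rewrite -abk !addnS -!addSn leq_addl.
by rewrite -[RHS](right_power_ann bk Jt' mxtx'); ring.
Qed.

End Generators.

End FibreProductGr.

Theorem theorem3p6
  (Q : comNzRingType) (mQ : idealr Q)
  (F : fieldType) (pQ : {rmorphism Q -> F}) (s k : nat)
  (Qlocal : local_ring mQ) (QF : residue_field mQ pQ)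
  (Qgor : gorenstein_artinian mQ) (llQ : loewy_length mQ s)
  (A B : comAlgType F) (gA : nat -> set A) (gB : nat -> set B)
  (pA : {rmorphism A -> F}) (pB : {rmorphism B -> F})
  (Agr : graded_algebra gA) (Bgr : graded_algebra gB)
  (Aproj : natural_projection gA pA) (Bproj : natural_projection gB pB)
  (Agor : gorenstein_artinian (hom_max gA))
  (llA : loewy_length (hom_max gA) s) (llB : loewy_length (hom_max gB) k)
  (k_ge1 : (1 <= k)%N) (s_gt : (k + 1 < s)%N)
  (phi : {rmorphism gr mQ -> fibre_prod pA pB})
  (phi_iso : graded_iso (gr_comp mQ) (fibre_comp gA gB) phi)
  (n : nat) (z : 'I_n -> Q)
  (Jann : ideal_gen (range z) `<=` ann (idealX mQ (k + 1)))
  (zbasis : quot_basis mQ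
     (idealD (ann (idealX mQ (k + 1))) (idealX mQ 2)) (idealX mQ 2) z)
  (m : nat) (y : 'I_m -> Q)
  (ygen : minimally_generates (fun i => initial_form mQ (y i))
     (phi @^-1` left_ideal (hom_max gA))) :
  let I := ideal_gen (range y) in
  let J := ideal_gen (range z) in
  [/\ [/\ embdim (hom_max gB) n, min_num_gens J n,
          idealD J (idealX mQ 2) = ann (idealX mQ (s - 1)) &
          k = 1%N -> ann (idealX mQ (s - 1)) `<=` idealD J (ann J)],
      [/\ minimally_generates (fun i => initial_form mQ (z i))
            (phi @^-1` right_ideal (hom_max gB)),
          minimally_generates
            (fun i : 'I_m + 'I_n =>
               match i with inl a => y a | inr b => z b end) mQ &
          (mQ : set Q) = idealD I J],
      idealM J (idealX mQ k) = socle mQ /\ idealX J k <> [set 0],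
      [/\ idealM I J `<=` idealX mQ 3,
          idealD (idealM (idealX I k) J) (idealX J (k + 1)) `<=` socle mQ &
          forall a b : nat, (a + b = k + 1)%N -> (2 <= b <= k)%N ->
            idealM (idealX I a) (idealX J b) = [set 0]] &
      forall i : nat, (k + 1 <= i)%N -> idealX mQ i = idealX I i].
Proof.
move=> I J; split; first split.
- exact: (embdim_right QF Qgor llQ
    Agr Bgr Aproj Bproj Agor llA llB s_gt phi_iso ygen Jann zbasis).
- exact: (right_gens_min_num QF zbasis).
- exact: (right_gens_mod2 QF Qgor llQ
    Agr Bgr Aproj Bproj Agor llA llB s_gt phi_iso ygen Jann zbasis).
- exact: (ann_sub_right_gens QF Qgor llQ
    Agr Bgr Aproj Bproj Agor llA llB s_gt phi_iso ygen Jann zbasis).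
- split; last exact: (max_eq_gens QF Qgor llQ
    Agr Bgr Aproj Bproj Agor llA llB s_gt phi_iso ygen Jann zbasis).
    apply: indep_minimally_generates (gr_right_indep QF llQ Bgr Bproj s_gt phi_iso Jann zbasis) _.
    exact: (right_gens_gr QF Qgor llQ
      Agr Bgr Aproj Bproj Agor llA llB s_gt phi_iso ygen Jann zbasis).
  exact: (max_minimally_generated QF Qgor llQ
    Agr Bgr Aproj Bproj Agor llA llB s_gt phi_iso ygen Jann zbasis).
- split; first exact: (right_gens_socle QF Qgor llQ
    Agr Bgr Aproj Bproj Agor llA llB k_ge1 s_gt phi_iso ygen Jann zbasis).
  exact: (right_powerN0 QF Qgor llQ
    Agr Bgr Aproj Bproj Agor llA llB k_ge1 s_gt phi_iso ygen Jann zbasis).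
- split.
  + apply: idealM_le => [|x t Ix Jt]; first exact: is_idealX.
    exact: (left_right_mul3 QF llQ Agr Bgr Aproj Bproj Agor llA s_gt phi_iso ygen Jann Ix Jt).
  + exact: (left_right_products_socle QF Qgor llQ
      Agr Bgr Aproj Bproj Agor llA llB k_ge1 s_gt phi_iso ygen Jann zbasis).
  + move=> a b; exact: (left_right_products_eq0 QF llQ
      Agr Bgr Aproj Bproj Agor llA s_gt phi_iso ygen Jann).
- move=> i; rewrite addn1.
  exact: (idealX_top QF llQ Agr Bgr Aproj Bproj llB phi_iso ygen).
Qed.
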